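(* Let $f:[0,1]\to\mathbb{R}^d$ be the self-affine function described in the context, and for $\alpha\in(0,\infty]$ let $\tilde E_f(\alpha):=\{t\in(0,1):\tilde\alpha_f(t)=\alpha\}$. (i) $\tilde E_f(\alpha)=\emptyset$ when $\alpha\notin[\alpha_{\min},\alpha_{\max}]\cup\{\infty\}$. (ii) $\tilde E_f(\infty)$ is empty if $\mathcal{I}_0=\emptyset$, and has Lebesgue measure one otherwise. (iii) $\dim_H\tilde E_f(\alpha)=\beta^*(\alpha)$ for all $\alpha\in(\alpha_{\min},\alpha_{\max})$. (iv) $\dim_H\tilde E_f(\alpha_{\min})=s_{\min}$ and $\dim_H\tilde E_f(\alpha_{\max})=s_{\max}$. (v) The maximum value of $\dim_H\tilde E_f(\alpha)$ over $\alpha\in[\alpha_{\min},\alpha_{\max}]$ is attained at $\hat\alpha$, and $\dim_H\tilde E_f(\hat\alpha)=\hat s$. Moreover, if $\mathcal{I}_0=\emptyset$, then $\tilde E_f(\hat\alpha)$ has Lebesgue measure one.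
   Context: Setting. Fix integers $d\geq 1$ and $m\geq 2$, let $\mathbf{a}=(0,0,\dots,0)$ and $\mathbf{b}=(1,0,\dots,0)$ in $\mathbb{R}^d$, and fix $\boldsymbol\varepsilon=(\varepsilon_1,\dots,\varepsilon_m)\in\{0,1\}^m$ (the signature). Let $S_1,\dots,S_m$ be contractive similitudes of $\mathbb{R}^d$ with ratios $\lambda_i:=\mathrm{Lip}(S_i)\in[0,1)$ (if $m\geq 3$ one or more $S_i$ may be constant, so $\lambda_i=0$; if $m=2$ all $\lambda_i>0$), satisfying $S_1((1-\varepsilon_1)\mathbf{a}+\varepsilon_1\mathbf{b})=\mathbf{a}$, $S_m(\varepsilon_m\mathbf{a}+(1-\varepsilon_m)\mathbf{b})=\mathbf{b}$, and $S_{i-1}(\varepsilon_{i-1}\mathbf{a}+(1-\varepsilon_{i-1})\mathbf{b})=S_i((1-\varepsilon_i)\mathbf{a}+\varepsilon_i\mathbf{b})$ for $i=2,\dots,m$. Let $c_1,\dots,c_m>0$ with $\sum_{i=1}^m c_i=1$, put $\sigma_i:=\sum_{j=1}^{i-1}c_j+\varepsilon_ic_i$, $\phi_i(t):=(-1)^{\varepsilon_i}c_it+\sigma_i$, and $I_i:=\phi_i([0,1])$. Then $f:[0,1]\to\mathbb{R}^d$ is the unique continuous function with $f(t)=S_i(f(\phi_i^{-1}(t)))$ for $t\in I_i$, $i=1,\dots,m$. It is assumed throughout that $(\lambda_1,\dots,\lambda_m)\neq(c_1,\dots,c_m)$. Nondirectional Hölder exponent. For $t_0\in(0,1)$ and $\alpha>0$,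 $f\in\tilde C^\alpha(t_0)$ means there is a constant $C$ with $|f(t)-f(t_0)|\leq C|t-t_0|^\alpha$ for all $t\in(0,1)$; and $\tilde\alpha_f(t):=\sup\{\alpha>0:f\in\tilde C^\alpha(t)\}\in[0,\infty]$. Notation. $\mathcal{I}_0:=\{i:\lambda_i=0\}$, $\mathcal{I}_+:=\{i:\lambda_i>0\}$ (which has at least two elements); $\rho_i:=\log\lambda_i/\log c_i$ for $i\in\mathcal{I}_+$; $\alpha_{\min}:=\min_{i\in\mathcal{I}_+}\rho_i$, $\alpha_{\max}:=\max_{i\in\mathcal{I}_+}\rho_i$. The nonnegative numbers $s_{\min},s_{\max},\hat s$ are defined by $\sum_{i:\rho_i=\alpha_{\min}}c_i^{s_{\min}}=1$, $\sum_{i:\rho_i=\alpha_{\max}}c_i^{s_{\max}}=1$, $\sum_{i\in\mathcal{I}_+}c_i^{\hat s}=1$, and $\hat\alpha:=\big(\sum_{i\in\mathcal{I}_+}c_i^{\hat s}\log\lambda_i\big)/\big(\sum_{i\in\mathcal{I}_+}c_i^{\hat s}\log c_i\big)$. For $q\in\mathbb{R}$, $\beta(q)$ is the unique real number with $\sum_{i\in\mathcal{I}_+}\lambda_i^qc_i^{\beta(q)}=1$, and $\beta^*(\alpha):=\inf_{q\in\mathbb{R}}\{\alpha q+\beta(q)\}$. $\dim_H$ is Hausdorff dimension. *)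

(* Defs.v *)
From HB Require Import structures.
From mathcomp Require Import all_boot all_order all_algebra.
From mathcomp Require Import all_classical all_reals all_analysis.

Set Implicit Arguments.
Unset Strict Implicit.
Unset Printing Implicit Defensive.

Import Order.TTheory GRing.Theory Num.Theory.
Import numFieldNormedType.Exports.

Local Open Scope classical_set_scope.
Local Open Scope ring_scope.

(* The library norm on 'rV[R]_d is the sup norm; similitudes are taken with
   respect to the Euclidean norm. *)
Definition enorm (R : realType) (d : nat) (v : 'rV[R]_d) : R :=
  Num.sqrt (\sum_(j < d) v 0 j ^+ 2).

(* A similitude of ratio r; the value r = 0 gives the constant maps. *)
Definition similitude (R : realType) (d : nat) (r : R)
    (S : 'rV[R]_d -> 'rV[R]_d) : Prop :=
  forall x y, enorm (S x - S y) = r * enorm (x - y).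

Definition pt_a (R : realType) (d : nat) : 'rV[R]_d := 0.

Definition pt_b (R : realType) (d : nat) : 'rV[R]_d :=
  \row_(j < d) ((j : nat) == 0%N)%:R.

Section parameters.
Variables (R : realType) (m : nat) (eps : 'I_m -> bool) (lam c : 'I_m -> R).

Definition startpt (d : nat) (i : 'I_m) : 'rV[R]_d :=
  (1 - (eps i)%:R) *: pt_a R d + (eps i)%:R *: pt_b R d.

Definition endpt (d : nat) (i : 'I_m) : 'rV[R]_d :=
  (eps i)%:R *: pt_a R d + (1 - (eps i)%:R) *: pt_b R d.

(* Indices run over 0, ..., m - 1 instead of 1, ..., m. *)
Record self_affine_system (d : nat) (S : 'I_m -> 'rV[R]_d -> 'rV[R]_d) :
    Prop := SelfAffineSystem {
  sas_dim : (1 <= d)%N ;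
  sas_size : (2 <= m)%N ;
  sas_ratio : forall i, 0 <= lam i < 1 ;
  sas_simil : forall i, similitude (lam i) (S i) ;
  sas_two : m = 2 -> forall i, 0 < lam i ;
  sas_first : forall i : 'I_m, i = 0%N :> nat -> S i (startpt d i) = pt_a R d ;
  sas_last : forall i : 'I_m, i.+1 = m -> S i (endpt d i) = pt_b R d ;
  sas_glue : forall i j : 'I_m, j = i.+1 :> nat ->
    S i (endpt d i) = S j (startpt d j) ;
  sas_weight : forall i, 0 < c i ;
  sas_weight_sum : \sum_(i < m) c i = 1 ;
  sas_nontrivial : lam <> c }.

Definition sigma (i : 'I_m) : R :=
  \sum_(j < m | (j < i)%N) c j + (eps i)%:R * c i.

Definition phi (i : 'I_m) (t : R) : R := (-1) ^+ (eps i) * c i * t + sigma i.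

Definition phi_inv (i : 'I_m) (t : R) : R :=
  (t - sigma i) / ((-1) ^+ (eps i) * c i).

Definition self_affine_function (d : nat) (S : 'I_m -> 'rV[R]_d -> 'rV[R]_d)
    (f : R -> 'rV[R]_d) : Prop :=
  {within `[0, 1], continuous f} /\
  forall i t, (phi i @` `[0, 1]) t -> f t = S i (f (phi_inv i t)).

(* Only meaningful where lam i > 0: the library sets ln 0 = 0. *)
Definition rho (i : 'I_m) : R := ln (lam i) / ln (c i).

(* Infimum and supremum of a finite nonempty set, hence its min and max. *)
Definition alpha_min : R := inf [set rho i | i in [set i | 0 < lam i]].

Definition alpha_max : R := sup [set rho i | i in [set i | 0 < lam i]].

Definition alpha_hat (s : R) : R :=
  (\sum_(i < m | 0 < lam i) c i `^ s * ln (lam i)) /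
  (\sum_(i < m | 0 < lam i) c i `^ s * ln (c i)).

End parameters.

Definition beta_star (R : realType) (beta : R -> R) (alpha : R) : \bar R :=
  ereal_inf [set (alpha * q + beta q)%:E | q in [set: R]].

Definition in_holder (R : realType) (d : nat) (f : R -> 'rV[R]_d)
    (t0 alpha : R) : Prop :=
  exists C : R, forall t, 0 < t < 1 ->
    enorm (f t - f t0) <= C * `|t - t0| `^ alpha.

(* The supremum is taken in [0, +oo], so it is 0 for the empty set. *)
Definition holder_exponent (R : realType) (d : nat) (f : R -> 'rV[R]_d)
    (t : R) : \bar R :=
  maxe 0%E
    (ereal_sup [set alpha%:E | alpha in [set a : R | 0 < a /\ in_holder f t a]]).

Definition level_set (R : realType) (d : nat) (f : R -> 'rV[R]_d)
    (alpha : \bar R) : set R :=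
  [set t | 0 < t < 1 /\ holder_exponent f t = alpha].

Section hausdorff.
Variable R : realType.

(* Used below for bounded sets only. *)
Definition diameter (U : set R) : R :=
  sup [set `|p.1 - p.2| | p in U `*` U].

(* |U|^s, with value 0 for the empty set even when s = 0. *)
Definition gauge (s : R) (U : set R) : \bar R :=
  if U == set0 then 0%E else (diameter U `^ s)%:E.

Definition delta_cover (delta : R) (A : set R) : set (nat -> set R) :=
  [set U | A `<=` \bigcup_n U n /\
    forall n x y, U n x -> U n y -> `|x - y| <= delta].

Definition hausdorff_content (s delta : R) (A : set R) : \bar R :=
  ereal_inf [set (\sum_(n <oo) gauge s (U n))%E | U in delta_cover delta A].

Definition hausdorff_measure (s : R) (A : set R) : \bar R :=
  ereal_sup [set hausdorff_content s delta A | delta in [set e : R | 0 < e]].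

Definition hausdorff_dim (A : set R) : \bar R :=
  ereal_inf [set s%:E | s in [set s : R | 0 <= s /\ hausdorff_measure s A = 0%E]].

(* Lebesgue measurability: Caratheodory measurability with respect to the
   outer measure extending the length of intervals. *)
Definition has_lebesgue_measure_one (A : set R) : Prop :=
  ((wlength (@idfun R))^*%mu).-cara.-measurable A /\
  completed_lebesgue_measure A = 1%E.

End hausdorff.

(* Main.v *)
Require Import Defs.
From HB Require Import structures.
From mathcomp Require Import all_boot all_order all_algebra.
From mathcomp Require Import all_classical all_reals all_analysis.
From mathcomp Require Import ring lra.

Import Order.TTheory GRing.Theory Num.Theory.
Import numFieldNormedType.Exports.

Local Open Scope classical_set_scope.
Local Open Scope ring_scope.

Set Implicit Arguments.
Unset Strict Implicit.
Unset Printing Implicit Defensive.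

(** A word [w] codes the interval [Phi w [0, 1]] of length [wt c w], on which
    [f] oscillates by a constant times [wt lam w].

    Upper bounds.  If [f] has exponent less than [al] at [t], then arbitrarily
    short intervals lying within their own length of [t] satisfy
    [wt c w `^ al <= wt lam w]; if the exponent is finite and greater than [al],
    then all short nonflat intervals containing [t] satisfy the reverse
    inequality.  In both cases
    [wt c w `^ s <= wt lam w `^ q * wt c w `^ (s - al * q)] for [q] of the
    appropriate sign, and the right-hand side is multiplicative in [w], so its
    sum over all nonflat words converges as soon as
    [\sum_i lam i `^ q * c i `^ (s - al * q) < 1].  The case [s = 1] gives the
    statements on Lebesgue measure, without any law of large numbers.

    Lower bounds.  A Cantor subset of the level set of [al] is built from
    blocks, chosen according to the sign of the current value of
    [ln (wt lam w) - al * ln (wt c w)] so as to keep that value bounded: the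
    exponent is then exactly [al] at every point.  Blocks carrying enough
    [s]-dimensional mass exist, for [s < beta_star beta al], by Cramer's tilting
    and Chernoff's bound.  Every block ends with a word whose interval is
    interior to [0, 1], so neighbouring intervals never matter.  The natural
    map from the Cantor set to [0, 1] is [s]-Holder, which bounds its dimension
    from below. *)

(** * Lebesgue outer measure and Hausdorff measures *)

(** A large increment of [f] near [t] need not show on any short interval containing [t]: it may
    come from a neighbour across a breakpoint. Two close points are therefore compared through a
    pair of meeting intervals, both of length comparable to their distance, and coverings use
    intervals enlarged by their own length. Flat words are a second obstacle: they satisfy every
    upper bound on [wt lam w] trivially, and no negative power of their weight is available. A
    finite exponent provides nonflat words of every length containing [t].

    The exponent [q] of the covering sums is the Legendre variable: [q = 0] yields [shat], and [q]
    tending to either infinity yields the two ends of the spectrum. At an end all letters push the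
    discrepancy to the same side, so it cannot be steered; blocks there use only the extreme
    letters, whose discrepancy is zero.

    Making the exponent exact at every point of the Cantor set removes any need for a measure on the
    level set: Lebesgue measure on the parameter interval, seen through the coding, does the work of
    a Frostman measure. *)

Section lebesgue_outer.
Variable R : realType.
Local Notation leb := ((wlength (@idfun R))^*%mu).

Lemma leb_itv (a b : R) : a <= b -> leb `[a, b]%classic = (b - a)%:E.
Proof.
move=> ab; have := lebesgue_measure_itv `[a, b].
rewrite /lebesgue_measure /lebesgue_stieltjes_measure /measure_extension /= => ->.
rewrite lte_fin; case: ltP => // ba.
by have -> : a = b; [apply/eqP; rewrite eq_le ab ba|rewrite subrr].
Qed.

Lemma leb_diam (U : set R) (D : R) : 0 <= D ->
  (forall x y, U x -> U y -> `|x - y| <= D) -> (leb U <= D%:E)%E.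
Proof.
move=> D0 UD; have [->|/set0P[x Ux]] := eqVneq U set0.
  by rewrite outer_measure0.
have lbU : has_inf U.
  split; first by exists x.
  by exists (x - D) => y Uy; have := UD _ _ Ux Uy; rewrite ler_norml; lra.
have iD : inf U <= inf U + D by lra.
rewrite [leRHS](_ : _ = leb `[inf U, inf U + D]%classic); last first.
  by rewrite leb_itv// addrAC subrr add0r.
apply: le_outer_measure => y Uy /=; rewrite in_itv/=; apply/andP; split.
  by apply: ge_inf => //; case: lbU.
rewrite -lerBlDr; apply: lb_le_inf; first by exists x.
by move=> z Uz; have := UD _ _ Uy Uz; rewrite ler_norml; lra.
Qed.

Lemma leb_cover (A : set R) (V : nat -> set R) (u : nat -> \bar R) :
  A `<=` \bigcup_n V n -> (forall n, leb (V n) <= u n)%E ->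
  (leb A <= \sum_(n <oo) u n)%E.
Proof.
move=> AV Vu; apply: (le_trans (le_outer_measure leb _ _ AV)).
apply: (le_trans (outer_measure_sigma_subadditive leb V)).
by apply: lee_nneseries => [n _ _|n _]; [exact: outer_measure_ge0|exact: Vu].
Qed.

Lemma leb_bigcup0 (V : nat -> set R) : (forall n, leb (V n) = 0%E) ->
  leb (\bigcup_n V n) = 0%E.
Proof.
move=> V0; apply/eqP; rewrite eq_le outer_measure_ge0 andbT.
apply: (le_trans (@leb_cover _ _ (fun=> 0%E) (@subset_refl _ _) _)).
  by move=> n; rewrite V0.
by rewrite eseries0.
Qed.

Lemma leb_sub0 (A B : set R) : A `<=` B -> leb B = 0%E -> leb A = 0%E.
Proof.
move=> AB B0; apply/eqP; rewrite eq_le outer_measure_ge0 andbT -B0.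
exact: le_outer_measure.
Qed.

Lemma leb_setU0 (A B : set R) : leb A = 0%E -> leb B = 0%E ->
  leb (A `|` B) = 0%E.
Proof.
move=> A0 B0; apply/eqP; rewrite eq_le outer_measure_ge0 andbT.
have <- : (leb A + leb B = 0)%E by rewrite A0 B0 adde0.
exact: outer_measureU2.
Qed.

Lemma leb_set1 (x : R) : leb [set x] = 0%E.
Proof.
apply/eqP; rewrite eq_le outer_measure_ge0 andbT.
by apply: leb_diam => // _ _ -> ->; rewrite subrr normr0.
Qed.

Lemma cara_leb0 (N : set R) : leb N = 0%E -> leb.-cara.-measurable N.
Proof.
move=> N0; apply: le_caratheodory_measurable => X.
apply: (@le_trans _ _ (leb (X `&` N) + leb (X `&` ~` N))%E) => //.
rewrite (@leb_sub0 (X `&` N) N) ?add0e//; apply: le_outer_measure; exact: subIsetl.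
Qed.

(** Measurability comes from writing [A] as a closed interval minus a null set; the two endpoints
    are thrown into the null set. *)
Lemma has_lebesgue_measure_one_null (A : set R) :
  A `<=` [set t | 0 < t < 1] -> leb ([set t | 0 < t < 1] `\` A) = 0%E ->
  has_lebesgue_measure_one A.
Proof.
move=> A01 N0; set N := _ `\` A in N0.
pose N' := N `|` [set 0; 1]%R.
have N'0 : leb N' = 0%E by do !apply: leb_setU0; rewrite // leb_set1.
have AE : A = `[0, 1]%classic `\` N'.
  apply/seteqP; split => x /=.
    move=> Ax; have /= x01 := A01 _ Ax; rewrite in_itv /=; split.
      by case/andP: x01 => /ltW -> /ltW ->.
    move=> [[]//|[x0|x1]]; first by rewrite x0 ltxx in x01.
    by rewrite x1 ltxx andbF in x01.
  rewrite in_itv/= => -[/andP[x0 x1] nN].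
  apply: contrapT => nA; apply: nN; have [->|x0'] := eqVneq x 0; first by right; left.
  have [->|x1'] := eqVneq x 1; first by right; right.
  by left; split => //=; rewrite !lt_def x0' x0 eq_sym x1' x1.
have m01 : leb.-cara.-measurable (`[0, 1]%classic : set R).
  by apply: sub_caratheodory; exact: (measurable_itv `[0, 1]).
split; first by rewrite AE; apply: measurableD => //; exact: cara_leb0.
rewrite -[LHS]/(leb A); apply/eqP; rewrite eq_le; apply/andP; split.
  rewrite -[1%:E]/(1%R%:E) -[X in X%:E](subr0 1) -leb_itv ?ler01//.
  by apply: le_outer_measure; rewrite AE; exact: subDsetl.
have <- : leb (`[0, 1]%classic : set R) = 1%E by rewrite leb_itv ?subr0.
apply: (@le_trans _ _ (leb (A `|` N'))).
  by apply: le_outer_measure; rewrite AE setDE setUIl setUCl setIT; exact: subsetUl.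
have <- : (leb A + leb N' = leb A)%E by rewrite N'0 adde0.
exact: outer_measureU2.
Qed.

End lebesgue_outer.

(** * Criteria for vanishing Hausdorff measure and for bounds on the dimension *)

Section hausdorff_tools.
Variable R : realType.
Local Notation leb := ((wlength (@idfun R))^*%mu).

Lemma diameter_ge (U : set R) (D x y : R) :
  (forall x y, U x -> U y -> `|x - y| <= D) -> U x -> U y ->
  `|x - y| <= diameter U.
Proof.
move=> UD Ux Uy; apply: ub_le_sup; last by exists (x, y).
by exists D => _ [[u v] [/= Uu Uv] <-]; exact: UD.
Qed.

Lemma diameter_le (U : set R) (D : R) : U !=set0 ->
  (forall x y, U x -> U y -> `|x - y| <= D) -> diameter U <= D.
Proof.
move=> [x Ux] UD; apply: ge_sup; first by exists `|x - x|; exists (x, x).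
by move=> _ [[u v] [/= Uu Uv] <-]; exact: UD.
Qed.

Lemma diameter_ge0 (U : set R) : 0 <= diameter U.
Proof.
rewrite /diameter; set E := [set _ | _ in _]; have [sE|nE] := pselect (has_sup E).
  have [[_ [[x y] Uxy _]] uE] := sE.
  by apply: le_trans (normr_ge0 (x - y)) _; apply: ub_le_sup => //; exists (x, y).
by rewrite sup_out.
Qed.

Lemma gauge_ge0 (s : R) (U : set R) : (0 <= gauge s U)%E.
Proof. by rewrite /gauge; case: ifP => // _; rewrite lee_fin powR_ge0. Qed.

Lemma gauge_le (s : R) (U : set R) (D : R) : 0 <= s -> 0 <= D ->
  (forall x y, U x -> U y -> `|x - y| <= D) -> (gauge s U <= (D `^ s)%:E)%E.
Proof.
move=> s0 D0 UD; rewrite /gauge; case: ifPn => [_|/set0P U0].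
  by rewrite lee_fin powR_ge0.
rewrite lee_fin; apply: ge0_ler_powR => //; rewrite ?nnegrE ?diameter_ge0//.
exact: diameter_le.
Qed.

Lemma hausdorff_measure_ge0 (s : R) (A : set R) : (0 <= hausdorff_measure s A)%E.
Proof.
apply: (@le_trans _ _ (hausdorff_content s 1 A)).
  apply: le_ereal_inf_tmp => _ [U _ <-]; apply: nneseries_ge0 => n _ _.
  exact: gauge_ge0.
by apply: ereal_sup_ubound; exists 1 => //=.
Qed.

Lemma hausdorff_measure_sub0 (s : R) (A B : set R) : A `<=` B ->
  hausdorff_measure s B = 0%E -> hausdorff_measure s A = 0%E.
Proof.
move=> AB B0; apply/eqP; rewrite eq_le hausdorff_measure_ge0 andbT -B0.
apply: ge_ereal_sup => _ [d d0 <-].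
apply: (@le_trans _ _ (hausdorff_content s d B)); last first.
  by apply: ereal_sup_ubound; exists d.
apply: ereal_inf_le_tmp => _ [U [BU Ud] <-]; exists U => //; split => //.
exact: subset_trans BU.
Qed.

(* Quantifying over finite subfamilies lets Borel-Cantelli arguments use finite
   sums only. *)
Lemma hausdorff_measure_cover0 (T : countType) (J : T -> set R) (d : T -> R)
    (s : R) (A : set R) : 0 <= s -> (forall w, 0 <= d w) ->
  (forall w x y, J w x -> J w y -> `|x - y| <= d w) ->
  (forall e : R, 0 < e -> exists P : T -> bool,
    [/\ A `<=` \bigcup_(w in [set w | P w]) J w,
      forall w, P w -> d w <= e &
      forall X : seq T, uniq X -> all P X -> \sum_(w <- X) d w `^ s <= e]) ->
  hausdorff_measure s A = 0%E.
Proof.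
move=> s0 d0 Jd H; apply/eqP; rewrite eq_le hausdorff_measure_ge0 andbT.
apply: ge_ereal_sup => _ [del /= del0 <-].
apply/lee_addgt0Pr => e e0; rewrite add0e.
have [P [AP Pd PX]] := H (Num.min e del) (ltac:(by rewrite lt_min e0 del0)).
(* Indices that code nothing, or an element outside [P], get the empty set, whose gauge is 0 even
   for [s = 0]; partial sums of the series are then bounded by sums over duplicate-free lists. *)
pose U n := if @pickle_inv T n is Some w then if P w then J w else set0 else set0.
apply: (@le_trans _ _ (\sum_(n <oo) gauge s (U n))%E).
  apply: ereal_inf_lbound; exists U => //; split.
    move=> t /AP[w /= Pw Jt]; exists (pickle w) => //.
    by rewrite /U pickleK_inv Pw.
  move=> n x y; rewrite /U; case: pickle_inv => // w; case: ifPn => // Pw Jx Jy.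
  by rewrite (le_trans (Jd _ _ _ Jx Jy))// (le_trans (Pd _ Pw))// ge_min lexx orbT.
have g0 n : (0 <= gauge s (U n))%E by exact: gauge_ge0.
apply: lime_le; first by apply: is_cvg_nneseries => n _ _.
apply: nearW => n.
pose X := [seq w <- pmap (@pickle_inv T) (iota 0 n) | P w].
have uX : uniq X.
  rewrite filter_uniq//; apply: (map_uniq (f := @pickle T)).
  rewrite pmap_filter; last exact: pickle_invK.
  by rewrite filter_uniq// iota_uniq.
have aX : all P X by apply/allP => w; rewrite mem_filter => /andP[].
apply: (@le_trans _ _ (\sum_(w <- X) d w `^ s)%:E); last first.
  by rewrite lee_fin (le_trans (PX _ uX aX))// ge_min lexx.
rewrite /X /index_iota subn0; elim: (iota 0 n) => [|k l IH].
  by rewrite !big_nil.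
rewrite big_cons /= {1}/U.
case: (@pickle_inv T k) => [w|] /=; last by rewrite /gauge eqxx add0e.
case: ifPn => Pw; last by rewrite /gauge eqxx add0e.
rewrite big_cons EFinD; apply: leeD => //; exact: gauge_le (Jd w).
Qed.

Lemma hausdorff_measure1_leb (A : set R) : hausdorff_measure 1 A = 0%E ->
  leb A = 0%E.
Proof.
move=> A0; apply/eqP; rewrite eq_le outer_measure_ge0 andbT.
have : (hausdorff_content 1 1 A <= 0)%E.
  by rewrite -A0; apply: ereal_sup_ubound; exists 1 => //=.
apply: le_trans; apply: le_ereal_inf_tmp => _ [U [AU Ud] <-].
apply: leb_cover AU _ => n; rewrite /gauge; case: ifPn => [/eqP ->|U0].
  by rewrite outer_measure0.
rewrite powRr1 ?diameter_ge0//; apply: leb_diam; first exact: diameter_ge0.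
by move=> x y Ux Uy; exact: diameter_ge (Ud n) Ux Uy.
Qed.

Lemma hausdorff_dim_ge0 (A : set R) : (0 <= hausdorff_dim A)%E.
Proof.
by apply: le_ereal_inf_tmp => _ [s [s0 _] <-]; rewrite lee_fin.
Qed.

Lemma hausdorff_dim_le (A : set R) (s : R) : 0 <= s ->
  (forall s', s < s' -> hausdorff_measure s' A = 0%E) ->
  (hausdorff_dim A <= s%:E)%E.
Proof.
move=> s0 H; apply/lee_addgt0Pr => e e0; apply: ereal_inf_lbound.
by exists (s + e) => //; split; [lra|apply: H; lra].
Qed.

(* A right inverse of a Holder map from [A] onto the unit interval plays the
   role of a Frostman measure on [A]. *)
Lemma hausdorff_dim_ge (A : set R) (h : R -> R) (C s : R) :
  0 < C -> 0 <= s ->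
  (forall y, 0 <= y < 1 -> A (h y)) ->
  (forall y y', 0 <= y < 1 -> 0 <= y' < 1 ->
    `|y - y'| <= C * `|h y - h y'| `^ s) ->
  (s%:E <= hausdorff_dim A)%E.
Proof.
move=> C0 s0 hA hC; apply: le_ereal_inf_tmp => _ [s' [s'0 A0] <-].
rewrite lee_fin leNgt; apply/negP => s's.
have {}s0 : 0 < s by exact: le_lt_trans s's.
(* Such a cover pulls back under [h] to a cover of [[0, 1)] of total length at most 1/2. Scale 1
   suffices: for diameters at most 1 the power [s'] dominates the power [s]. *)
have : (hausdorff_content s' 1 A < (C^-1 / 2)%:E)%E.
  apply: (@le_lt_trans _ _ 0%E); last by rewrite lte_fin divr_gt0// invr_gt0.
  by rewrite -A0; apply: ereal_sup_ubound; exists 1 => //=.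
move=> /ereal_inf_lt[_ [U [AU Ud] <-]].
pose I := [set y : R | 0 <= y < 1].
have IU : (leb I <= \sum_(n <oo) (C%:E * gauge s' (U n)))%E.
  apply: (@leb_cover _ _ (fun n => I `&` h @^-1` U n)).
    by move=> y Iy; have [n _ Un] := AU _ (hA _ Iy); exists n.
  move=> n; have [U0|/set0P Un0] := eqVneq (U n) set0.
    by rewrite U0 preimage_set0 setI0 outer_measure0 mule_ge0 ?gauge_ge0// lee_fin ltW.
  have d1 : diameter (U n) <= 1 by apply: diameter_le => // x y; exact: Ud.
  have d0 := diameter_ge0 (U n).
  rewrite /gauge ifN; last exact/set0P.
  rewrite -EFinM; apply: leb_diam; first by rewrite mulr_ge0 ?powR_ge0// ltW.
  move=> x y [Ix Ux] [Iy Uy]; apply: (le_trans (hC _ _ Ix Iy)).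
  rewrite ler_pM2l//.
  have hd : `|h x - h y| <= diameter (U n) by exact: diameter_ge (Ud n) Ux Uy.
  apply: (@le_trans _ _ (diameter (U n) `^ s)).
    by apply: ge0_ler_powR => //; rewrite ?nnegrE ?(ltW s0).
  have [->|dn0] := eqVneq (diameter (U n)) 0.
    by rewrite powR0 ?gt_eqF// powR_ge0.
  by apply: ger_powR; [rewrite lt_neqAle eq_sym dn0 d0 d1|exact: ltW].
rewrite nneseriesZl in IU; last by move=> *; exact: gauge_ge0.
move=> UC; have : (leb I <= (C * (C^-1 / 2))%:E)%E.
  by apply: (le_trans IU); rewrite EFinM lee_pmul2l// ltW.
rewrite mulrA divff ?gt_eqF// => I2.
(* Any closed interval inside [[0, 1)] of length above 1/2 gives the contradiction. *)
pose I0 : set R := `[0, 2 / 3]%classic.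
have : (leb I0 <= leb I)%E.
  apply: le_outer_measure => x; rewrite /I0 /I /= in_itv/= => /andP[x0 x1].
  by rewrite x0/=; lra.
rewrite leb_itv; last lra.
by move=> /le_trans /(_ I2); rewrite lee_fin; lra.
Qed.

End hausdorff_tools.

(** * Words and their intervals *)

Section geometry.
Variables (R : realType) (m : nat) (eps : 'I_m -> bool) (c : 'I_m -> R).
Hypotheses (m_ge2 : (2 <= m)%N) (c_gt0 : forall i, 0 < c i).
Hypothesis c_sum : \sum_(i < m) c i = 1.

Local Notation phi := (phi eps c).

Definition wt (v : 'I_m -> R) (w : seq 'I_m) : R := \prod_(i <- w) v i.

Definition slope (w : seq 'I_m) : R := wt (fun i => (-1) ^+ eps i * c i) w.

(** The first letter acts last, so extending a word on the right shrinks its interval. *)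
Definition word_map (w : seq 'I_m) (t : R) : R := foldr phi t w.

Local Notation Phi := word_map.

Definition breakpt (k : nat) : R := \sum_(j < m | (j < k)%N) c j.

Lemma wt_nil v : wt v [::] = 1. Proof. exact: big_nil. Qed.

Lemma wt_cons v i w : wt v (i :: w) = v i * wt v w.
Proof. exact: big_cons. Qed.

Lemma wt_cat v w w' : wt v (w ++ w') = wt v w * wt v w'.
Proof. exact: big_cat. Qed.

Lemma wt_gt0 v w : (forall i, i \in w -> 0 < v i) -> 0 < wt v w.
Proof.
elim: w => [|i w IH] H; first by rewrite wt_nil.
rewrite wt_cons mulr_gt0 ?H ?inE ?eqxx// IH// => j jw.
by rewrite H// inE jw orbT.
Qed.

Lemma wt_ge0 v w : (forall i, 0 <= v i) -> 0 <= wt v w.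
Proof. by move=> v0; exact: prodr_ge0. Qed.

Lemma breakpt0 : breakpt 0 = 0.
Proof. by rewrite /breakpt big1. Qed.

Lemma breakptm : breakpt m = 1.
Proof. by rewrite /breakpt -[RHS]c_sum; apply: eq_bigl => i; rewrite ltn_ord. Qed.

Lemma breakptS (i : 'I_m) : breakpt i.+1 = breakpt i + c i.
Proof.
rewrite /breakpt (bigD1 i) //= addrC; congr (_ + _).
by apply: eq_bigl => j; rewrite ltnS -val_eqE/= ltn_neqAle andbC.
Qed.

Lemma breakpt_le (k l : nat) : (k <= l)%N -> breakpt k <= breakpt l.
Proof.
move=> kl; rewrite /breakpt [leRHS](bigID (fun j : 'I_m => (j < k)%N))/=.
rewrite [X in _ <= X + _](eq_bigl (fun j : 'I_m => (j < k)%N)) => [|j].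
  by rewrite lerDl sumr_ge0// => i _; rewrite ltW.
by apply/andP/idP => [[]//|jk]; split => //; exact: leq_trans kl.
Qed.

Lemma breakpt_ge0 k : 0 <= breakpt k.
Proof. by rewrite -breakpt0 breakpt_le. Qed.

Lemma breakpt_le1 k : (k <= m)%N -> breakpt k <= 1.
Proof. by move=> km; rewrite -breakptm breakpt_le. Qed.

Lemma phiE i t : phi i t = breakpt i + c i * (if eps i then 1 - t else t).
Proof.
by rewrite /Defs.phi /sigma /breakpt; case: (eps i); rewrite /= ?expr1 ?expr0; ring.
Qed.

Lemma phi_itv (i : 'I_m) (t : R) : 0 <= t <= 1 -> breakpt i <= phi i t <= breakpt i.+1.
Proof.
move=> t01; rewrite phiE breakptS lerDl lerD2l.
have ci := c_gt0 i; rewrite mulr_ge0 ?(ltW ci)//=; last by case: (eps _) => /=; lra.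
by rewrite ler_piMr ?(ltW ci)//; case: (eps _) => /=; lra.
Qed.

Lemma phi_itv_oo (i : 'I_m) (t : R) : 0 < t < 1 -> breakpt i < phi i t < breakpt i.+1.
Proof.
move=> t01; rewrite phiE breakptS ltrDl ltrD2l.
have ci := c_gt0 i; rewrite mulr_gt0//=; last by case: (eps _) => /=; lra.
by rewrite gtr_pMr//; case: (eps _) => /=; lra.
Qed.

Lemma phi01 (i : 'I_m) (t : R) : 0 <= t <= 1 -> 0 <= phi i t <= 1.
Proof.
move=> /(phi_itv i)/andP[h1 h2]; rewrite (le_trans (breakpt_ge0 i) h1)/=.
exact: (le_trans h2 (breakpt_le1 (ltn_ord i))).
Qed.

Lemma breakpt_start (i : 'I_m) : breakpt i = phi i (eps i)%:R.
Proof. by rewrite phiE; case: (eps _) => /=; rewrite ?subrr mulr0 addr0. Qed.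

Lemma breakpt_end (i : 'I_m) : breakpt i.+1 = phi i (1 - (eps i)%:R).
Proof.
by rewrite phiE breakptS; case: (eps _) => /=; rewrite ?subrr ?subr0 mulr1.
Qed.

Lemma breakpt_end_neg (i : 'I_m) : breakpt i.+1 = phi i (~~ eps i)%:R.
Proof.
rewrite breakpt_end; congr (phi i _).
by case: (eps i) => /=; rewrite ?mulr1n ?mulr0n ?subrr ?subr0.
Qed.

Lemma boolR01 (b : bool) : 0 <= (b%:R : R) <= 1.
Proof. by case: b; rewrite /= ?lexx ler01. Qed.

Lemma phi_surj (i : 'I_m) (t : R) : breakpt i <= t <= breakpt i.+1 ->
  exists2 x, 0 <= x <= 1 & t = phi i x.
Proof.
rewrite breakptS => /andP[t0 t1]; have ci := c_gt0 i.
pose y := (t - breakpt i) / c i.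
have y0 : 0 <= y by rewrite divr_ge0 ?subr_ge0// ltW.
have y1 : y <= 1 by rewrite ler_pdivrMr// mul1r lerBlDl.
have cy : c i * y = t - breakpt i by rewrite mulrC divfK// gt_eqF.
exists (if eps i then 1 - y else y); first by case: (eps _) => /=; lra.
have -> : t = breakpt i + c i * y by rewrite cy; ring.
by rewrite phiE; case: (eps _) => /=; ring.
Qed.

Lemma breakpt_cover (t : R) : 0 <= t <= 1 ->
  exists i : 'I_m, breakpt i <= t <= breakpt i.+1.
Proof.
move=> /andP[t0 t1].
suff H k : (k <= m)%N -> t <= breakpt k ->
    t = 0 \/ exists i : 'I_m, breakpt i <= t <= breakpt i.+1.
  have [//|->|//] := H m (leqnn m); first by rewrite breakptm.
  have m0 : (0 < m)%N by exact: ltnW.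
  by exists (Ordinal m0); rewrite breakpt_ge0 /= breakpt0 lexx.
elim: k => [_|k IH km tk].
  by rewrite breakpt0 => t0'; left; apply/eqP; rewrite eq_le t0 t0'.
have [tk'|tk'] := leP t (breakpt k); first by apply: IH => //; exact: ltnW.
by right; exists (Ordinal km); rewrite /= tk (ltW tk').
Qed.

Lemma phi_cover (t : R) : 0 <= t <= 1 ->
  exists i, exists2 x, 0 <= x <= 1 & t = phi i x.
Proof.
by move=> /breakpt_cover[i /phi_surj[x x01 tx]]; exists i, x.
Qed.

Lemma phi_sub i x y : phi i x - phi i y = (-1) ^+ eps i * c i * (x - y).
Proof. by rewrite /Defs.phi; ring. Qed.

Lemma phi_inj i : injective (phi i).
Proof.
move=> x y xy; have := phi_sub i x y; rewrite xy subrr => /esym/eqP.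
by rewrite !mulf_eq0 signr_eq0/= gt_eqF//= subr_eq0 => /eqP.
Qed.

Lemma Phi_cat w w' t : Phi (w ++ w') t = Phi w (Phi w' t).
Proof. by rewrite /word_map foldr_cat. Qed.

Lemma Phi_sub w x y : Phi w x - Phi w y = slope w * (x - y).
Proof.
elim: w => [|i w IH]; first by rewrite /slope wt_nil mul1r.
by rewrite /= phi_sub -/(Phi w x) -/(Phi w y) IH /slope wt_cons mulrA.
Qed.

Lemma slope_norm w : `|slope w| = wt c w.
Proof.
rewrite /slope; elim: w => [|i w IH]; first by rewrite !wt_nil normr1.
by rewrite !wt_cons normrM IH normrM normr_sign mul1r gtr0_norm.
Qed.

Lemma cw_gt0 w : 0 < wt c w.
Proof. by apply: wt_gt0 => i _. Qed.

Lemma Phi_dist w x y : `|Phi w x - Phi w y| = wt c w * `|x - y|.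
Proof. by rewrite Phi_sub normrM slope_norm. Qed.

Lemma Phi_surj w t : exists x, t = Phi w x.
Proof.
have s0 : slope w != 0 by rewrite -normr_gt0 slope_norm cw_gt0.
exists ((t - Phi w 0) / slope w); have := Phi_sub w ((t - Phi w 0) / slope w) 0.
by rewrite subr0 [slope w * _]mulrC divfK// => /subIr.
Qed.

Lemma Phi01 w (t : R) : 0 <= t <= 1 -> 0 <= Phi w t <= 1.
Proof. by move=> t01; elim: w => //= i w; exact: phi01. Qed.

Lemma Phi_oo w (t : R) : 0 < t < 1 -> 0 < Phi w t < 1.
Proof.
move=> t01; elim: w => //= i w /(phi_itv_oo i)/andP[w0 w1].
rewrite (le_lt_trans (breakpt_ge0 i) w0)/=.
exact: (lt_le_trans w1 (breakpt_le1 (ltn_ord i))).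
Qed.

Lemma Phi_cover n (t : R) : 0 <= t <= 1 ->
  exists w, size w = n /\ exists2 x, 0 <= x <= 1 & t = Phi w x.
Proof.
elim: n t => [|n IH] t t01; first by exists [::]; split => //; exists t.
have [i [x x01 ->]] := phi_cover t01; have [w [<- [y y01 ->]]] := IH _ x01.
by exists (i :: w); split => //; exists y.
Qed.

Lemma phi_disjoint (i j : 'I_m) (x y : R) : i != j -> 0 < x < 1 -> 0 <= y <= 1 ->
  phi i x != phi j y.
Proof.
move=> ij /(phi_itv_oo i)/andP[x0 x1] /(phi_itv j)/andP[y0 y1].
have [ij'|ji] := ltnP i j.
  by rewrite lt_eqF// (lt_le_trans x1)// (le_trans _ y0)// breakpt_le.
have {}ji : (j < i)%N by rewrite ltn_neqAle ji andbT val_eqE eq_sym.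
by rewrite gt_eqF// (le_lt_trans y1)// (le_lt_trans _ x0)// breakpt_le.
Qed.

Lemma Phi_disjoint v w (x y : R) : size v = size w -> v != w -> 0 <= y <= 1 ->
  Phi v x = Phi w y -> ~ (0 < x < 1).
Proof.
elim: v w => [|i v IH] [|j w]//= [] vw; rewrite eqseq_cons => + y01 xy x01.
have [ij /= vw'|ij _] := eqVneq i j.
  by move: xy; rewrite -ij => /phi_inj H; exact: (IH w vw vw' y01 H).
have vx01 := Phi_oo v x01.
by move/eqP: xy; rewrite -/(Phi v x) -/(Phi w y) (negbTE (phi_disjoint ij vx01 _))// Phi01.
Qed.

Lemma Phi_outside w (x y k : R) : k <= x <= 1 - k -> ~ (0 < y < 1) ->
  wt c w * k <= `|Phi w x - Phi w y|.
Proof.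
move=> xk y01; rewrite Phi_dist ler_pM2l ?cw_gt0// ler_normr.
have [y0|y0] := leP y 0; first by apply/orP; left; lra.
have [y1|y1] := leP 1 y; first by apply/orP; right; lra.
by exfalso; apply: y01; rewrite y0 y1.
Qed.

Lemma weight_bounds : exists a b : R,
  [/\ 0 < a, a <= b, b < 1 & forall i, a <= c i <= b].
Proof.
pose a := \prod_(i < m) c i.
have c1 i : c i <= 1.
  by rewrite -c_sum (bigD1 i)//= lerDl sumr_ge0// => j _; rewrite ltW.
have ac i : a <= c i.
  rewrite /a (bigD1 i)//= ler_piMr ?(ltW (c_gt0 i))//.
  by apply: prodr_ile1 => j; rewrite (ltW (c_gt0 j)) c1.
have a0 : 0 < a by apply: prodr_gt0 => i _.
have cb i : c i <= 1 - a.
  have [j ji] : exists j : 'I_m, j != i.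
    case: m m_ge2 i => [|[|n]]// _ i; exists (if i == ord0 then ord_max else ord0).
    by case: (eqVneq i ord0) => [->|]; rewrite // eq_sym.
  rewrite -c_sum (bigD1 i)//= (bigD1 j)//= -addrA lerDl.
  have : 0 <= \sum_(k < m | (k != i) && (k != j)) c k.
    by rewrite sumr_ge0// => k _; rewrite ltW.
  by have := ac j; lra.
pose i0 : 'I_m := Ordinal (ltnW m_ge2).
exists a, (1 - a); split => //; first by have := ac i0; have := cb i0; lra.
  lra.
by move=> i; rewrite ac cb.
Qed.

Lemma cw_le b w : (forall i, c i <= b) -> wt c w <= b ^+ size w.
Proof.
move=> cb; elim: w => [|i w IH]; first by rewrite wt_nil.
by rewrite wt_cons exprS; apply: ler_pM => //; rewrite ltW ?cw_gt0.
Qed.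

Lemma cw_ge a w : 0 <= a -> (forall i, a <= c i) -> a ^+ size w <= wt c w.
Proof.
move=> a0 ac; elim: w => [|i w IH]; first by rewrite wt_nil.
by rewrite wt_cons exprS; apply: ler_pM => //; rewrite exprn_ge0.
Qed.

(** * Words at the scale of a given distance *)

Section scale.
Variables a b : R.
Hypotheses (a_gt0 : 0 < a) (ab : a <= b) (b_lt1 : b < 1).
Hypothesis cab : forall i, a <= c i <= b.

(** The integer [n] records how far [r] is below the scale [a]; passing to a subinterval lowers it
    by one, which drives the two inductions below. *)
Let rescale (r : R) i n : a * b ^+ n.+1 <= r -> a * b ^+ n <= r / c i.
Proof.
move=> rn; rewrite ler_pdivlMr//; apply: le_trans rn; rewrite exprSr mulrA.
have /andP[_ cb] := cab i; have b0 : 0 <= b by exact: le_trans (ltW a_gt0) ab.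
by rewrite ler_wpM2l// mulr_ge0 ?exprn_ge0// ltW.
Qed.

Let scale_nil (r : R) : a <= r -> r <= 1 -> r <= wt c [::] <= r / a.
Proof. by move=> ar r1; rewrite wt_nil r1 ler_pdivlMr// mul1r. Qed.

Let scale_cons (r : R) i v : r / c i <= wt c v <= r / c i / a ->
  r <= wt c (i :: v) <= r / a.
Proof.
move=> /andP[h1 h2]; rewrite wt_cons [c i * _]mulrC -ler_pdivrMr// h1/=.
by rewrite -ler_pdivlMr// mulrAC.
Qed.

Let exists_scale (r : R) : 0 < r -> exists n, a * b ^+ n <= r.
Proof.
have b0 : 0 <= b by exact: le_trans (ltW a_gt0) ab.
move=> r0; have b1 : `|b| < 1 by rewrite ger0_norm.
have /cvgrPdist_le/(_ (r / a) (divr_gt0 r0 a_gt0))[n _ /(_ n (leqnn n))] :=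
  cvg_expr b1.
rewrite /= sub0r normrN ger0_norm ?exprn_ge0//.
by move=> H; exists n; rewrite mulrC -ler_pdivlMr.
Qed.

(** A point close to an end of [[0, 1]] shares with it an interval of comparable length: such
    intervals are obtained by descending along the end. *)
Lemma scale_endpoint (e : bool) (t r : R) : 0 <= t <= 1 -> 0 < r <= 1 ->
  `|t - e%:R| <= r ->
  exists v, [/\ exists2 x, 0 <= x <= 1 & t = Phi v x,
                exists2 y, 0 <= y <= 1 & e%:R = Phi v y &
                r <= wt c v <= r / a].
Proof.
move: a_gt0 => a0 t01 /andP[r0 r1] ter.
have [n rn] := exists_scale r0.
elim: n e t r t01 r0 r1 ter rn => [|n IH] e t r t01 r0 r1 ter rn.
all: have [ar|ra] := leP a r; first by
  exists [::]; split; [by exists t|by exists e%:R; rewrite ?ler0n ?lern1 ?leq_b1|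
  exact: scale_nil].
  by move: rn; rewrite expr0 mulr1; lra.
(* As [r < a], the point [t] lies in the outermost interval at the end [e], and [e] is the image of
   an end [d] of [[0, 1]] determined by the orientation. *)
have [i [x x01 tx] [d ed]] : exists2 i : 'I_m,
    (exists2 x, 0 <= x <= 1 & t = phi i x) & exists d : bool, e%:R = phi i d%:R.
  move: e ter => [] /= ter.
    have m1 : (m.-1 < m)%N by rewrite prednK//; exact: ltnW.
    pose i := Ordinal m1.
    have im : i.+1 = m by rewrite /= prednK//; exact: ltnW.
    have := breakptS i; rewrite im breakptm => cim.
    exists i.
      apply: phi_surj; rewrite im breakptm.
      by have := cab i; move: ter; rewrite ler_norml; lra.
    by exists (~~ eps i); rewrite -breakpt_end_neg im breakptm.
  pose i := Ordinal (ltnW m_ge2).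
  have := breakptS i; rewrite breakpt0 add0r => c0i.
  exists i; last by exists (eps i); rewrite -breakpt_start breakpt0.
  apply: phi_surj; rewrite c0i breakpt0.
  by have := cab i; move: ter; rewrite ler_norml; lra.
have rc1 : r / c i <= 1.
  by rewrite ler_pdivrMr// mul1r; have := cab i; lra.
have dx : `|x - d%:R| <= r / c i.
  move: ter; rewrite tx ed phi_sub !normrM normr_sign mul1r gtr0_norm//.
  by rewrite ler_pdivlMr// mulrC.
have [v [[y y01 xy] [z z01 dz] rv]] :=
  IH d x (r / c i) x01 (divr_gt0 r0 (c_gt0 i)) rc1 dx (rescale i rn).
exists (i :: v); split; last exact: scale_cons.
  by exists y; rewrite //= -/(Phi v y) -xy.
by exists z; rewrite //= -/(Phi v z) -dz.
Qed.

(** One interval would not do: arbitrarily close points may be separated by a breakpoint of the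
    first generation. *)
Definition linked (t u : R) := exists v w,
  [/\ exists2 x, 0 <= x <= 1 & t = Phi v x,
      exists2 x, 0 <= x <= 1 & u = Phi w x,
      exists x y, [/\ 0 <= x <= 1, 0 <= y <= 1 & Phi v x = Phi w y],
      `|t - u| <= wt c v <= `|t - u| / a &
      `|t - u| <= wt c w <= `|t - u| / a].

Let linked_sym t u : linked t u -> linked u t.
Proof.
move=> [v [w [h1 h2 [x [y [x01 y01 xy]]] h3 h4]]].
by exists w, v; rewrite distrC; split => //; exists y, x.
Qed.

Let linked_lt n (t u : R) : t < u -> 0 <= t <= 1 -> 0 <= u <= 1 ->
  a * b ^+ n <= u - t -> linked t u.
Proof.
move: a_gt0 => a0; elim: n t u => [|n IH] t u tu t01 u01.
all: have r0 : 0 < u - t by rewrite subr_gt0.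
all: have rE : `|t - u| = u - t by rewrite distrC gtr0_norm.
all: have r1 : u - t <= 1 by lra.
all: rewrite /linked rE; move: (u - t) r0 r1 rE => r r0 r1 rE rn.
all: have [ar|ra] := leP a r; first by
  exists [::], [::]; split; [exists t|exists u|exists 0, 0; rewrite lexx ler01|
  exact: scale_nil|exact: scale_nil].
  by move: rn; rewrite expr0 mulr1; lra.
have rE' : r = u - t by rewrite -rE distrC gtr0_norm// subr_gt0.
have [i it] := breakpt_cover t01; have [j ju] := breakpt_cover u01.
have [x x01 tx] := phi_surj it; have [y y01 uy] := phi_surj ju.
have rc k : 0 < r / c k <= 1.
  by rewrite divr_gt0//= ler_pdivrMr// mul1r; have := cab k; lra.
(* Within a common first interval the problem is rescaled; a reversed orientation exchanges the two
   points, whence [linked_sym]. *)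
have [ij|ij] := eqVneq i j.
  rewrite -ij in uy.
  have xyr : `|x - y| = r / c i.
    rewrite -rE tx uy phi_sub !normrM normr_sign mul1r [`|c i|]gtr0_norm//.
    by rewrite mulrAC divff ?mul1r ?gt_eqF.
  have xy : x != y by rewrite -subr_eq0 -normr_gt0 xyr; case/andP: (rc i).
  have [v [w [[x' x'01 ?] [y' y'01 ?] [p [q [p01 q01 pq]]]]]] : linked x y.
    have [xy'|yx|/eqP] := ltgtP x y; last by rewrite (negbTE xy).
      by apply: IH => //; rewrite -[y - x]gtr0_norm ?subr_gt0// distrC xyr rescale.
    apply: linked_sym.
    by apply: IH => //; rewrite -[x - y]gtr0_norm ?subr_gt0// xyr rescale.
  rewrite xyr => h1 h2.
  exists (i :: v), (i :: w); split; try exact: scale_cons.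
  - by exists x' => //; rewrite tx; congr (phi i _).
  - by exists y' => //; rewrite uy; congr (phi i _).
  - by exists p, q; split => //=; congr (phi i _).
have /andP[it0 it1] := it; have /andP[ju0 ju1] := ju.
(* An interval between the two would have length at least [a > r]. So [t] and [u] lie on either side
   of a single breakpoint, and [scale_endpoint] joins each of them to it. *)
have ji : j = i.+1 :> nat.
  apply/eqP; rewrite eqn_leq; apply/andP; split; last first.
    have [//|ji] := ltnP i j.
    have {}ji : (j < i)%N by rewrite ltn_neqAle ji andbT val_eqE eq_sym.
    by have := breakpt_le ji; lra.
  rewrite leqNgt; apply/negP => ij2.
  have i1m : (i.+1 < m)%N by exact: (ltn_trans ij2 (ltn_ord j)).
  have := breakptS (Ordinal i1m); have := breakpt_le ij2 => /=.
  by have := cab (Ordinal i1m); lra.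
have te : `|x - (~~ eps i)%:R| <= r / c i.
  have eE := breakpt_end_neg i.
  have : `|t - breakpt i.+1| <= r.
    by rewrite distrC ger0_norm ?subr_ge0// rE' -ji; lra.
  rewrite tx eE phi_sub !normrM normr_sign mul1r gtr0_norm//.
  by rewrite ler_pdivlMr// mulrC.
have ue : `|y - (eps j)%:R| <= r / c j.
  have : `|u - breakpt j| <= r.
    by rewrite ger0_norm ?subr_ge0// rE' ji; lra.
  rewrite uy breakpt_start phi_sub !normrM normr_sign mul1r gtr0_norm//.
  by rewrite ler_pdivlMr// mulrC.
have [v [[x' x'01 ?] [p p01 vp] h1]] := scale_endpoint x01 (rc i) te.
have [w [[y' y'01 ?] [q q01 wq] h2]] := scale_endpoint y01 (rc j) ue.
exists (i :: v), (j :: w); split; try exact: scale_cons.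
- by exists x' => //; rewrite tx; congr (phi i _).
- by exists y' => //; rewrite uy; congr (phi j _).
- exists p, q; split => //=; rewrite -/(Phi v p) -/(Phi w q) -vp -wq.
  by rewrite -breakpt_start ji breakpt_end_neg.
Qed.

Lemma scale_pair (t u : R) : 0 <= t <= 1 -> 0 <= u <= 1 -> t != u -> linked t u.
Proof.
move=> t01 u01 tu; have [tu'|ut|/eqP] := ltgtP t u; last by rewrite (negbTE tu).
  have [n] := exists_scale (ltac:(by rewrite subr_gt0) : 0 < u - t).
  exact: linked_lt.
have [n rn] := exists_scale (ltac:(by rewrite subr_gt0) : 0 < t - u).
by apply: linked_sym; exact: linked_lt rn.
Qed.

End scale.

(** For [i < j] the interval of [i] stays away from 1, having that of [j] on its right. A second
    letter keeps it away from 0. Only [i] and [j] occur, so that the word is nonflat as soon as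
    these letters are. *)
Lemma interior_word (i j : 'I_m) : i != j -> exists u k,
  [/\ all [pred l | (l == i) || (l == j)] u, 0 < k &
      forall x, 0 <= x <= 1 -> k <= Phi u x <= 1 - k].
Proof.
wlog ij : i j / (i < j)%N.
  move=> H ij; have [ij'|ji] := ltnP i j; first exact: H.
  have {}ji : (j < i)%N by rewrite ltn_neqAle ji andbT val_eqE eq_sym.
  have [|u [k [au k0 uk]]] := H _ _ ji; first by rewrite eq_sym.
  by exists u, k; split => //; apply: sub_all au => l /=; rewrite orbC.
move=> _; have := breakpt_le ij; rewrite breakptS => ci1.
have := breakpt_le1 (ltn_ord j); rewrite breakptS => cj1.
have bi0 := breakpt_ge0 i; have ci := c_gt0 i; have cj := c_gt0 j.
pose k := Num.min (c i * c i) (Num.min (c i * c j) (c j)).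
have k1 : k <= c i * c i by rewrite ge_min lexx.
have k2 : k <= c i * c j by rewrite !ge_min lexx orbT.
have k3 : k <= c j by rewrite !ge_min lexx !orbT.
(* If [phi i] is increasing, the second interval must avoid 0, and [j] does since [i] precedes it;
   if decreasing, it must avoid 1, and [i] does. *)
exists [:: i; if eps i then i else j], k; split.
- by rewrite /= eqxx/=; case: (eps _); rewrite eqxx ?orbT.
- by rewrite !lt_min !mulr_gt0.
move=> x x01; apply/andP; split; last first.
  have /(phi_itv i)/andP[_] := phi01 (if eps i then i else j) x01.
  by rewrite /= breakptS; lra.
rewrite /= phiE; case: (eps i).
  have /andP[_] := phi_itv i x01; rewrite breakptS => h.
  have : c i * c j <= c i * (1 - phi i x) by rewrite ler_pM2l//; lra.
  lra.
have /andP[h _] := phi_itv j x01.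
have : c i * c i <= c i * phi j x by rewrite ler_pM2l//; lra.
lra.
Qed.

End geometry.

(** * Oscillation of a self-affine function *)

Section euclidean_norm.
Variables (R : realType) (d : nat).
Implicit Types u v : 'rV[R]_d.

Lemma enorm_ge0 u : 0 <= enorm u.
Proof. exact: sqrtr_ge0. Qed.

Lemma enorm_sqr u : enorm u ^+ 2 = \sum_(j < d) u 0 j ^+ 2.
Proof. by rewrite sqr_sqrtr// sumr_ge0// => j _; exact: sqr_ge0. Qed.

Lemma enormN u : enorm (- u) = enorm u.
Proof. by congr Num.sqrt; apply: eq_bigr => j _; rewrite mxE sqrrN. Qed.

Lemma enorm_subC u v : enorm (u - v) = enorm (v - u).
Proof. by rewrite -opprB enormN. Qed.

Lemma enorm0 : enorm (0 : 'rV[R]_d) = 0.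
Proof. by rewrite /enorm big1 ?sqrtr0// => j _; rewrite mxE expr0n. Qed.

Lemma enorm0_eq0 u : enorm u = 0 -> u = 0.
Proof.
move=> u0; have := enorm_sqr u; rewrite u0 expr0n/= => /esym/eqP.
rewrite psumr_eq0 => [/allP H|j _]; last exact: sqr_ge0.
apply/rowP => j; rewrite mxE; apply/eqP.
by have := H j (mem_index_enum _); rewrite sqrf_eq0.
Qed.

(* The constant 2 spares the Cauchy-Schwarz inequality: Holder exponents do
   not see multiplicative constants. *)
Lemma enormD_le u v : enorm (u + v) <= 2 * (enorm u + enorm v).
Proof.
have n0 := enorm_ge0; rewrite -(ler_pXn2r (n := 2))// ?nnegrE ?mulr_ge0 ?addr_ge0//.
apply: (@le_trans _ _ (2 * (enorm u ^+ 2 + enorm v ^+ 2))); last first.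
  by have := n0 u; have := n0 v; nra.
rewrite !enorm_sqr -big_split mulr_sumr; apply: ler_sum => j _ /=.
by rewrite mxE -subr_ge0 [leRHS](_ : _ = (u 0 j - v 0 j) ^+ 2) ?sqr_ge0//; ring.
Qed.

Lemma enorm_tri u v w : enorm (u - w) <= 2 * (enorm (u - v) + enorm (v - w)).
Proof. by rewrite -[u - w](subrKA v); exact: enormD_le. Qed.

Lemma enorm_pt_b : (1 <= d)%N -> enorm (pt_b R d) = 1.
Proof.
case: d => // n _; rewrite /enorm big_ord_recl big1 => [|j _].
  by rewrite mxE /= expr1n addr0 sqrtr1.
by rewrite mxE /= expr0n.
Qed.

End euclidean_norm.

(** * Comparing the exponent with a number *)

Section holder_exponent_theory.
Variables (R : realType) (d : nat) (f : R -> 'rV[R]_d).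

Lemma holder_exponent_ge (t a : R) : 0 < a -> in_holder f t a ->
  (a%:E <= holder_exponent f t)%E.
Proof.
move=> a0 Ha; rewrite le_max; apply/orP; right.
by apply: ereal_sup_ubound; exists a.
Qed.

Lemma holder_exponent_le (t a : R) : 0 <= a ->
  (forall a', a < a' -> ~ in_holder f t a') -> (holder_exponent f t <= a%:E)%E.
Proof.
move=> a0 H; rewrite ge_max lee_fin a0/=.
apply: ge_ereal_sup => _ [a' /= [_ Ha'] <-]; rewrite lee_fin leNgt.
by apply/negP => /H.
Qed.

Lemma holder_exponent_gt (t a : R) : 0 <= a -> (a%:E < holder_exponent f t)%E ->
  exists2 a', a < a' & in_holder f t a'.
Proof.
move=> a0 H; apply: contrapT => nH; move: H; rewrite ltNge => /negP; apply.
by apply: holder_exponent_le => // a' aa' Ha'; apply: nH; exists a'.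
Qed.

Lemma holder_exponent_lt (t a : R) : 0 < a -> (holder_exponent f t < a%:E)%E ->
  ~ in_holder f t a.
Proof.
by move=> a0 H Ha; have := holder_exponent_ge a0 Ha; rewrite leNgt H.
Qed.

Lemma holder_exponent_pinfty (t : R) : (forall a, 0 < a -> in_holder f t a) ->
  holder_exponent f t = +oo%E.
Proof.
move=> H; apply/eqP; rewrite -leye_eq leNgt; apply/negP.
have e0 : (0 <= holder_exponent f t)%E by rewrite le_max lexx.
move: e0; case E : (holder_exponent f t) => [r| |]//; rewrite lee_fin => r0 _.
have r1 : 0 < r + 1 by lra.
by have := holder_exponent_ge r1 (H _ r1); rewrite E lee_fin; lra.
Qed.

End holder_exponent_theory.

(** * Increments of [f] over the coding intervals *)

Section self_affine_function_theory.
Variables (R : realType) (d m : nat) (eps : 'I_m -> bool).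
Variables (S : 'I_m -> 'rV[R]_d -> 'rV[R]_d) (lam c : 'I_m -> R).
Variable f : R -> 'rV[R]_d.
Hypothesis Hsys : self_affine_system eps lam c S.
Hypothesis Hf : self_affine_function eps c S f.

Let m_ge2 := sas_size Hsys.
Let c_gt0 := sas_weight Hsys.
Let c_sum := sas_weight_sum Hsys.

Local Notation phi := (phi eps c).
Local Notation Phi := (word_map eps c).
Local Notation breakpt := (breakpt c).

Lemma lam_ge0 i : 0 <= lam i.
Proof. by case/andP: (sas_ratio Hsys i). Qed.

Lemma lam_lt1 i : lam i < 1.
Proof. by case/andP: (sas_ratio Hsys i). Qed.

Lemma c_lt1 i : c i < 1.
Proof.
have [a [b [_ _ b1 H]]] := weight_bounds m_ge2 c_gt0 c_sum.
by have := H i; lra.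
Qed.

Lemma f_phi i (x : R) : 0 <= x <= 1 -> f (phi i x) = S i (f x).
Proof.
move=> x01; have [_ H] := Hf.
have Ht : (phi i @` `[0, 1]) (phi i x) by exists x => //=; rewrite in_itv.
rewrite (H _ _ Ht);congr (S i (f _)); rewrite /phi_inv /Defs.phi addrK mulrAC divff ?mul1r//.
by rewrite mulf_neq0 ?signr_eq0// gt_eqF.
Qed.

Lemma f_phi_dist i (x y : R) : 0 <= x <= 1 -> 0 <= y <= 1 ->
  enorm (f (phi i x) - f (phi i y)) = lam i * enorm (f x - f y).
Proof. by move=> x01 y01; rewrite !f_phi// (sas_simil Hsys). Qed.

Lemma f_Phi_dist w (x y : R) : 0 <= x <= 1 -> 0 <= y <= 1 ->
  enorm (f (Phi w x) - f (Phi w y)) = wt lam w * enorm (f x - f y).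
Proof.
move=> x01 y01; elim: w => [|i w IH] /=; first by rewrite wt_nil mul1r.
rewrite f_phi_dist; try exact: (Phi01 eps c_gt0 c_sum).
by rewrite -/(Phi w x) -/(Phi w y) IH wt_cons mulrA.
Qed.

Lemma f_bounded : exists2 D : R, 0 < D &
  forall x y : R, 0 <= x <= 1 -> 0 <= y <= 1 -> enorm (f x - f y) <= D.
Proof.
have bnd j : exists M : R, forall x, 0 <= x <= 1 -> `|f x 0 j| <= M.
  have cj : {within `[0, 1], continuous (fun x => f x 0 j)}.
    move=> x; apply: (@continuous_comp _ _ _ _ (fun M : 'rV[R]_d => M 0 j)).
      exact: (Hf.1 x).
    exact: coord_continuous.
  have [p _ Hp] := EVT_max ler01 cj; have [q _ Hq] := EVT_min ler01 cj.
  exists (`|f p 0 j| + `|f q 0 j|) => x x01.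
  have := Hp x; have := Hq x; rewrite in_itv /= x01 => /(_ isT) h1 /(_ isT) h2.
  have := ler_norm (f p 0 j); have := ler_norm (- f q 0 j); rewrite normrN.
  have := normr_ge0 (f p 0 j); have := normr_ge0 (f q 0 j).
  by rewrite ler_norml; lra.
have [M HM] := choice bnd; pose E := Num.sqrt (\sum_(j < d) M j ^+ 2).
have E0 : 0 <= E by exact: sqrtr_ge0.
have fE x : 0 <= x <= 1 -> enorm (f x) <= E.
  move=> x01; apply: ler_wsqrtr; apply: ler_sum => j _.
  rewrite -real_normK ?num_real// ler_pXn2r// ?nnegrE//; first exact: HM.
  exact: le_trans (HM j x x01).
exists (4 * E + 1) => [|x y x01 y01]; first by lra.
apply: (le_trans (enormD_le _ _)); rewrite enormN.
by have := fE _ x01; have := fE _ y01; lra.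
Qed.

(** The errors [u] and [v] at the two ends are each a ratio below 1 times one of [u] and [v], so
    their maximum vanishes. *)
Lemma f0_f1 : f 0 = pt_a R d /\ f 1 = pt_b R d.
Proof.
pose u := enorm (f 0 - pt_a R d); pose v := enorm (f 1 - pt_b R d).
have h0 : 0 <= (0 : R) <= 1 by rewrite lexx ler01.
have h1 : 0 <= (1 : R) <= 1 by rewrite lexx ler01.
have m1 : (m.-1 < m)%N by rewrite prednK//; exact: ltnW.
pose p := Ordinal (ltnW m_ge2); pose q := Ordinal m1.
have qm : q.+1 = m by rewrite /= prednK//; exact: ltnW.
have uE : u = lam p * (if eps p then v else u).
  rewrite {1}/u -(breakpt0 c) -[0%N]/(p : nat) (breakpt_start eps) f_phi ?boolR01//.
  rewrite -(sas_first Hsys (i := p))// (sas_simil Hsys); congr (_ * _).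
  rewrite /startpt; case: (eps p) => /=.
    by rewrite /v subrr scale0r add0r scale1r.
  by rewrite /u subr0 scale1r scale0r addr0.
have vE : v = lam q * (if eps q then u else v).
  rewrite {1}/v -(breakptm c_sum) -{2}qm (breakpt_end_neg eps) f_phi ?boolR01//.
  rewrite -(sas_last Hsys (i := q))// (sas_simil Hsys); congr (_ * _).
  rewrite /endpt; case: (eps q) => /=.
    by rewrite /u subrr scale0r addr0 scale1r.
  by rewrite /v subr0 scale1r scale0r add0r.
have u0 : 0 <= u by exact: enorm_ge0.
have v0 : 0 <= v by exact: enorm_ge0.
have lp0 := lam_ge0 p; have lp1 := lam_lt1 p.
have lq0 := lam_ge0 q; have lq1 := lam_lt1 q.
have [u00 v00] : u = 0 /\ v = 0.
  have mx0 : Num.max u v <= 0.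
    rewrite leNgt; apply/negP => mx0.
    have lt (l x : R) : 0 <= l -> l < 1 -> 0 <= x -> x <= Num.max u v -> l * x < Num.max u v.
      by move=> l0 l1 x0 xm; have [->|x0'] := eqVneq x 0; [rewrite mulr0|nra].
    have uM : u <= Num.max u v by rewrite le_max lexx.
    have vM : v <= Num.max u v by rewrite le_max lexx orbT.
    have uM' : u < Num.max u v by rewrite {1}uE; apply: lt => //; case: ifP.
    have vM' : v < Num.max u v by rewrite {1}vE; apply: lt => //; case: ifP.
    have : Num.max u v < Num.max u v by rewrite {1}gt_max uM' vM'.
    by rewrite ltxx.
  by move: mx0; rewrite ge_max => /andP[h h']; split; apply/eqP; rewrite eq_le ?h ?h' ?u0 ?v0.
split; first by apply/eqP; rewrite -subr_eq0; apply/eqP; exact: enorm0_eq0.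
by apply/eqP; rewrite -subr_eq0; apply/eqP; exact: enorm0_eq0.
Qed.

Lemma f01_dist : enorm (f 0 - f 1) = 1.
Proof.
have [-> ->] := f0_f1; rewrite enorm_subC /pt_a subr0 enorm_pt_b//.
exact: (sas_dim Hsys).
Qed.

Lemma f_breakpt_dist (i : 'I_m) : enorm (f (breakpt i) - f (breakpt i.+1)) = lam i.
Proof.
rewrite (breakpt_start eps) (breakpt_end_neg eps) f_phi_dist ?boolR01//.
by case: (eps i) => /=; rewrite ?[enorm (f 1 - _)]enorm_subC f01_dist mulr1.
Qed.

(** With at most one nonflat letter [k], [f] takes a single value at the breakpoints on each side of
    [k], and the unit distance from [f 0] to [f 1] would equal [lam k < 1]. *)
Lemma two_positive_ratios : exists i j : 'I_m, [/\ i != j, 0 < lam i & 0 < lam j].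
Proof.
apply: contrapT => H.
have [k Hk] : exists k : 'I_m, forall i, i != k -> lam i = 0.
  have [[k lk]|H0] := pselect (exists k, 0 < lam k); last first.
    exists (Ordinal (ltnW m_ge2)) => i _; apply/eqP; rewrite eq_le lam_ge0 andbT.
    by rewrite leNgt; apply/negP => li; apply: H0; exists i.
  exists k => i ik; apply/eqP; rewrite eq_le lam_ge0 andbT leNgt.
  by apply/negP => li; apply: H; exists i, k.
have step (i : 'I_m) : i != k -> f (breakpt i.+1) = f (breakpt i).
  move=> /Hk li; apply/eqP; rewrite eq_sym -subr_eq0; apply/eqP.
  by apply: enorm0_eq0; rewrite f_breakpt_dist.
have low n : (n <= k)%N -> f (breakpt n) = f 0.
  elim: n => [|n IH] nk; first by rewrite breakpt0.
  have nm : (n < m)%N by exact: (leq_trans nk (ltnW (ltn_ord k))).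
  by rewrite (step (Ordinal nm)) ?IH ?(ltnW nk)// -val_eqE/= ltn_eqF.
have high n : (k < n)%N -> (n <= m)%N -> f (breakpt n) = f (breakpt k.+1).
  elim: n => // n IH; rewrite ltnS leq_eqVlt => /orP[/eqP -> //|kn] nm.
  by rewrite (step (Ordinal nm)) ?IH ?(ltnW nm)// -val_eqE/= gtn_eqF.
have := f_breakpt_dist k; rewrite low// -(high m)// (breakptm c_sum) f01_dist.
by have := lam_lt1 k; lra.
Qed.

(** The Hölder condition tests points of the open interval only, and [Phi w] may send 0 or 1 to an
    end; interior witnesses are mapped to interior points. *)
Lemma interior_pair : exists x y : R,
  [/\ 0 < x < 1, 0 < y < 1 & 0 < enorm (f x - f y)].
Proof.
have [i [j [ij li lj]]] := two_positive_ratios.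
have [u [k [au k0 uk]]] := interior_word eps c_gt0 c_sum ij.
exists (Phi u 0), (Phi u 1); split.
- by have := uk 0; rewrite lexx ler01 => /(_ isT); lra.
- by have := uk 1; rewrite lexx ler01 => /(_ isT); lra.
rewrite f_Phi_dist ?lexx ?ler01// f01_dist mulr1; apply: wt_gt0 => l lu.
by have := allP au _ lu; rewrite /= => /orP[/eqP ->|/eqP ->].
Qed.

(** One of two fixed points [p], [q] has a value far from [f x]. The divisor 4 is twice the constant
    2 of [enorm_tri]. *)
Lemma oscillation_lower : exists2 k : R, 0 < k & forall w (x : R), 0 <= x <= 1 ->
  exists t, [/\ 0 < t < 1, `|t - Phi w x| <= wt c w &
    k * wt lam w <= enorm (f t - f (Phi w x))].
Proof.
have [p [q [p01 q01 pq]]] := interior_pair.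
exists (enorm (f p - f q) / 4) => [|w x x01]; first by rewrite divr_gt0.
have cl (z : R) : 0 < z < 1 -> 0 <= z <= 1 by move=> /andP[/ltW -> /ltW ->].
have near (z : R) : 0 < z < 1 -> `|Phi w z - Phi w x| <= wt c w.
  move=> z01; rewrite Phi_dist// ler_piMr//; first exact: ltW (cw_gt0 c_gt0 w).
  by rewrite ler_norml; lra.
have pc := cl _ p01; have qc := cl _ q01.
have tri := enorm_tri (f p) (f x) (f q); rewrite [enorm (f x - f q)]enorm_subC in tri.
have l0 : 0 <= wt lam w by apply: wt_ge0 => i; exact: lam_ge0.
have [h|h] := leP (enorm (f p - f q) / 4) (enorm (f p - f x)).
  exists (Phi w p); rewrite (Phi_oo eps c_gt0 c_sum)// near//; split => //.
  by rewrite f_Phi_dist// mulrC ler_wpM2l.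
exists (Phi w q); rewrite (Phi_oo eps c_gt0 c_sum)// near//; split => //.
by rewrite f_Phi_dist// mulrC ler_wpM2l//; lra.
Qed.

Lemma in_holder_word (t a : R) : 0 <= a -> in_holder f t a ->
  exists2 K : R, 0 < K & forall w (x : R), 0 <= x <= 1 -> t = Phi w x ->
    wt lam w <= K * wt c w `^ a.
Proof.
move=> a0 [C HC]; have [k k0 Hk] := oscillation_lower.
exists ((`|C| + 1) / k) => [|w x x01 tw].
  by rewrite divr_gt0// ltr_wpDl.
have [z [z01 zt kz]] := Hk w x x01; rewrite -tw in zt kz.
rewrite mulrAC ler_pdivlMr// mulrC (le_trans kz)// (le_trans (HC z z01))//.
apply: (@le_trans _ _ (`|C| * `|z - t| `^ a)).
  by rewrite ler_wpM2r ?powR_ge0// ler_norm.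
apply: ler_pM; rewrite ?powR_ge0//; first by rewrite lerDl.
by apply: ge0_ler_powR; rewrite ?nnegrE// ltW// cw_gt0.
Qed.

(** The increment is split at a common point of the two linked intervals. The point [u] need not lie
    in the interval of [v], but it is within one length of it, so it is covered by the enlarged
    interval. *)
Lemma oscillation_upper : exists a D : R, [/\ 0 < a, 0 < D &
  forall t u : R, 0 <= t <= 1 -> 0 <= u <= 1 -> t != u -> exists v w,
  [/\ exists2 x, 0 <= x <= 1 & t = Phi v x,
      exists2 y, 0 <= y <= 1 & `|u - Phi v y| <= wt c v,
      exists2 x, 0 <= x <= 1 & u = Phi w x,
      `|t - u| <= wt c v <= `|t - u| / a /\
      `|t - u| <= wt c w <= `|t - u| / a &
      enorm (f t - f u) <= D * (wt lam v + wt lam w)]].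
Proof.
have [a [b [a0 ab b1 cab]]] := weight_bounds m_ge2 c_gt0 c_sum.
have [D D0 HD] := f_bounded.
exists a, (2 * D); split => // [|t u t01 u01 tu]; first by rewrite mulr_gt0.
have [v [w [[x x01 tx] [y y01 uy] [p [q [p01 q01 pq]]] hv hw]]] :=
  scale_pair eps m_ge2 c_gt0 c_sum a0 ab b1 cab t01 u01 tu.
exists v, w; split => //; [by exists x| |by exists y|].
  by exists x => //; rewrite -tx distrC; case/andP: hv.
apply: (le_trans (enorm_tri _ (f (Phi v p)) _)).
rewrite -mulrA ler_wpM2l// mulrDr; apply: lerD.
  by rewrite tx f_Phi_dist// mulrC ler_wpM2r ?HD// wt_ge0// => i; exact: lam_ge0.
by rewrite pq uy f_Phi_dist// mulrC ler_wpM2r ?HD// wt_ge0// => i; exact: lam_ge0.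
Qed.

(* A point all of whose intervals of some generation are flat is interior to
   the union of these intervals. *)
Lemma flat_in_holder (t a : R) n : 0 < t < 1 -> 0 < a ->
  (forall w (x : R), size w = n -> 0 <= x <= 1 -> t = Phi w x -> wt lam w = 0) ->
  in_holder f t a.
Proof.
move=> t01 a0 H; have [D D0 HD] := f_bounded.
have cl (z : R) : 0 < z < 1 -> 0 <= z <= 1 by move=> /andP[/ltW -> /ltW ->].
(* Intervals are closed, and there are finitely many of generation [n]: close enough to [t], a point
   lies only in intervals that also contain [t]. *)
pose P (w : n.-tuple 'I_m) (z : R) :=
  (exists2 x : R, 0 <= x <= 1 & z = Phi w x) ->
  exists2 x : R, 0 <= x <= 1 & t = Phi w x.
have : \forall z \near t, forall w, P w z.
  suff : forall w, \forall z \near t, P w z by exact: (@filter_forall R _ P (nbhs t) _).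
  move=> w; rewrite /P; have [x tx] := Phi_surj eps c_gt0 w t.
  have [x01|x01] := boolP (0 <= x <= 1); first by near=> z => _; exists x.
  pose e := Num.max (- x) (x - 1).
  have e0 : 0 < e by rewrite lt_max; move: x01; rewrite negb_and -!ltNge; lra.
  have ce0 : 0 < wt c w * e by rewrite mulr_gt0// cw_gt0.
  near=> z => -[y y01 zy].
  have : `|t - z| < wt c w * e by near: z; apply/nbhs_ballP; exists (wt c w * e).
  rewrite tx zy Phi_dist// ltr_pM2l ?cw_gt0// ltNge => /negP[].
  by rewrite ge_max !ler_normr; apply/andP; split; apply/orP; [right|left]; lra.
move=> /nbhs_ballP[e /= e0 He].
(* Increments vanish within distance [e]; beyond it the bound [D] on all increments is enough. *)
exists (D / e `^ a) => z z01; have [ze|ez] := ltP `|t - z| e.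
  have [w [wn [x x01 zw]]] := Phi_cover eps m_ge2 c_gt0 c_sum n (cl _ z01).
  have [|y y01 tw] := He z ze (tcast wn (in_tuple w)).
    by exists x => //; rewrite val_tcast.
  rewrite val_tcast /= in tw.
  rewrite zw tw f_Phi_dist// (H w y)// mul0r.
  by rewrite mulr_ge0 ?powR_ge0// divr_ge0 ?powR_ge0// ltW.
apply: (le_trans (HD _ _ (cl _ z01) (cl _ t01))).
rewrite mulrAC ler_pdivlMr ?powR_gt0// ler_wpM2l ?(ltW D0)//.
by apply: ge0_ler_powR; rewrite ?nnegrE ?(ltW e0) ?(ltW a0)// distrC.
Unshelve. all: by end_near. Qed.

End self_affine_function_theory.

(** * Upper bounds by coverings *)

Lemma ltr_powR (R : realType) (x a b : R) : 0 < x < 1 -> a < b -> x `^ b < x `^ a.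
Proof.
move=> x01 ab; have /andP[x0 _] := x01.
by rewrite /powR gt_eqF// ltr_expR ltr_nM2r// ln_lt0.
Qed.

Section words.
Variables (R : realType) (m : nat).
Implicit Types (V : 'I_m -> R) (A : seq 'I_m) (w : seq 'I_m).

Fixpoint words A n : seq (seq 'I_m) :=
  if n is n'.+1 then [seq i :: w | i <- A, w <- words A n'] else [:: [::]].

Lemma mem_words A n w : (w \in words A n) = (size w == n) && all (mem A) w.
Proof.
elim: n w => [|n IH] w; first by case: w => [|? ?]; rewrite inE.
apply/allpairsP/idP => [[[i v] /= [iA]]|].
  by rewrite IH => /andP[sv av] -> /=; rewrite eqSS sv iA.
case: w => [//|i v] /=; rewrite eqSS => /and3P[sv iA av].
by exists (i, v); split => //=; rewrite IH sv.
Qed.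

Lemma words_uniq A n : uniq A -> uniq (words A n).
Proof.
move=> uA; elim: n => //= n IH; apply: allpairs_uniq => //.
by move=> [i v] [j w] _ _ /= [-> ->].
Qed.

Lemma sum_words A V n : \sum_(w <- words A n) wt V w = (\sum_(i <- A) V i) ^+ n.
Proof.
elim: n => [|n IH]; first by rewrite big_seq1 wt_nil expr0.
rewrite big_allpairs_dep exprS -IH mulr_suml; apply: eq_bigr => i _.
by rewrite mulr_sumr; apply: eq_bigr => w _; rewrite wt_cons.
Qed.

Lemma sum_sub_uniq (T : eqType) (X Y : seq T) (F : T -> R) : uniq X -> uniq Y ->
  {subset X <= Y} -> (forall x, 0 <= F x) -> \sum_(x <- X) F x <= \sum_(x <- Y) F x.
Proof.
move=> uX uY XY F0; rewrite [leRHS](bigID (mem X))/=.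
have -> : \sum_(x <- Y | x \in X) F x = \sum_(x <- X) F x.
  rewrite -big_filter; apply: perm_big; apply: uniq_perm => //.
    exact: filter_uniq.
  by move=> x; rewrite mem_filter andb_idr//; exact: XY.
by rewrite lerDl sumr_ge0.
Qed.

(** A geometric series: the words of one length [k] have total weight the [k]-th power of the sum of
    the letters. *)
Lemma sum_long_words V N (X : seq (seq 'I_m)) : (forall i, 0 <= V i) ->
  \sum_(i < m) V i < 1 -> uniq X -> all (fun w => N <= size w)%N X ->
  (1 - \sum_(i < m) V i) * \sum_(w <- X) wt V w <= (\sum_(i < m) V i) ^+ N.
Proof.
move=> V0 th1 uX aX; set th := \sum_(i < m) V i in th1 *.
have th0 : 0 <= th by exact: sumr_ge0.
(* The subtracted power makes the bound telescope when the words of length [N + j] are added. *)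
suff H j : uniq X -> all (fun w => N <= size w < N + j)%N X ->
    (1 - th) * \sum_(w <- X) wt V w <= th ^+ N - th ^+ (N + j).
  pose M := \max_(w <- X) size w.
  apply: (le_trans (H M.+1 uX _)); last by rewrite gerBl exprn_ge0.
  apply/allP => w wX; rewrite (allP aX)//= addnS ltnS.
  by apply: leq_trans (leq_addl _ _); exact: leq_bigmax_seq.
elim: j {uX aX} X => [|j IH] X uX aX.
  rewrite addn0 subrr (_ : X = [::]) ?big_nil ?mulr0//.
  by case: X {uX} aX => //= w X; rewrite addn0 ltnNge andbN.
rewrite (bigID (fun w => size w == N + j)%N)/= mulrDr.
have h1 : \sum_(w <- X | (size w == N + j)%N) wt V w <= th ^+ (N + j).
  rewrite /th -big_filter.
  have <- := sum_words (index_enum 'I_m) V (N + j).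
  apply: sum_sub_uniq; rewrite ?filter_uniq ?words_uniq ?index_enum_uniq//.
    move=> w; rewrite mem_filter mem_words => /andP[-> _]/=.
    by apply/allP => i _; exact: mem_index_enum.
  by move=> w; exact: wt_ge0.
have h2 := IH [seq w <- X | size w != N + j]%N (filter_uniq _ uX).
rewrite big_filter in h2.
have {}h2 : (1 - th) * \sum_(w <- X | (size w != N + j)%N) wt V w <=
    th ^+ N - th ^+ (N + j).
  apply: h2; apply/allP => w; rewrite mem_filter => /andP[wNj wX].
  have /andP[-> wN] := allP aX _ wX.
  by rewrite ltn_neqAle wNj/= -ltnS -addnS.
have h3 : (1 - th) * \sum_(w <- X | (size w == N + j)%N) wt V w <=
    (1 - th) * th ^+ (N + j) by rewrite ler_wpM2l// subr_ge0 ltW.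
apply: (le_trans (lerD h3 h2)).
by rewrite mulrBl mul1r addnS exprS; lra.
Qed.

End words.

(** * Hausdorff measure of the sets of small and of large exponents *)

Section upper_bound.
Variables (R : realType) (d m : nat) (eps : 'I_m -> bool).
Variables (S : 'I_m -> 'rV[R]_d -> 'rV[R]_d) (lam c : 'I_m -> R).
Variable f : R -> 'rV[R]_d.
Hypothesis Hsys : self_affine_system eps lam c S.
Hypothesis Hf : self_affine_function eps c S f.

Let m_ge2 := sas_size Hsys.
Let c_gt0 := sas_weight Hsys.
Let c_sum := sas_weight_sum Hsys.

Local Notation Phi := (word_map eps c).

Let cl01 (z : R) : 0 < z < 1 -> 0 <= z <= 1.
Proof. by move=> /andP[/ltW -> /ltW ->]. Qed.

(** Borel-Cantelli: bad words of length at least [N] cover [A] after enlargement, and their gauges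
    are bounded by the tail of a convergent geometric series. *)
Lemma hausdorff_measure_words0 V (s : R) (bad : seq 'I_m -> Prop) (A : set R) :
  0 < s -> (forall i, 0 <= V i) -> \sum_(i < m) V i < 1 ->
  (forall w, bad w -> wt c w `^ s <= wt V w) ->
  (forall t N, A t -> exists w, [/\ (N <= size w)%N, bad w &
     exists2 y : R, 0 <= y <= 1 & `|t - Phi w y| <= wt c w]) ->
  hausdorff_measure s A = 0%E.
Proof.
move=> s0 V0 V1 badV HA; have [a [b [a0 ab b1 cab]]] := weight_bounds m_ge2 c_gt0 c_sum.
pose J w := [set t : R | exists2 y : R, 0 <= y <= 1 & `|t - Phi w y| <= wt c w].
(* The interval of [w] and one more length on each side. *)
pose dd w := 3 * wt c w.
have cw0 w : 0 <= wt c w by exact: ltW (cw_gt0 c_gt0 w).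
apply: (@hausdorff_measure_cover0 _ _ J dd) => //; first exact: ltW.
- by move=> w; rewrite /dd mulr_ge0.
- move=> w x y [p p01 xp] [q q01 yq].
  have pq : `|Phi w p - Phi w q| <= wt c w.
    by rewrite (Phi_dist _ c_gt0) ler_piMr// ler_norml; lra.
  by rewrite /dd; move: xp yq pq; rewrite !ler_norml; lra.
move=> e e0; set th := \sum_(i < m) V i in V1.
have th0 : 0 <= th by exact: sumr_ge0.
have cvgx (x y : R) : 0 <= x < 1 -> 0 < y -> \forall n \near \oo, x ^+ n <= y.
  move=> /andP[x0 x1] y0; have xx : `|x| < 1 by rewrite ger0_norm.
  have /cvgrPdist_le/(_ y y0) := cvg_expr xx.
  by apply: filterS => n; rewrite sub0r normrN ger0_norm// exprn_ge0.
have [N /= N1 N2] : exists2 N, b ^+ N <= e / 3 & th ^+ N <= e * (1 - th) / 3 `^ s.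
  have h1 := cvgx b (e / 3) (ltac:(lra)) (ltac:(lra)).
  have t1 : 0 < e * (1 - th) / 3 `^ s.
    by rewrite divr_gt0 ?powR_gt0// mulr_gt0// subr_gt0.
  have h2 := cvgx th _ (ltac:(by rewrite th0 V1)) t1.
  have [N _ HN] := filterI h1 h2; exists N; by have [] := HN N (leqnn N).
exists (fun w => `[< (N <= size w)%N /\ bad w >]); split.
- move=> t /(HA t N)[w [Nw bw Jw]]; exists w => //=; exact/asboolP.
- move=> w /asboolP[Nw _]; rewrite /dd mulrC -ler_pdivlMr//.
  have cb i : c i <= b by case/andP: (cab i).
  apply: le_trans (cw_le c_gt0 w cb) _; apply: le_trans N1.
  by apply: ler_wiXn2l => //; lra.
move=> X uX aX.
have h1 : \sum_(w <- X) dd w `^ s <= 3 `^ s * \sum_(w <- X) wt V w.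
  rewrite mulr_sumr big_seq [leRHS]big_seq; apply: ler_sum => w wX.
  have /asboolP[_ bw] := allP aX _ wX.
  by rewrite /dd powRM// ler_pM2l ?powR_gt0//; exact: badV.
have h2 := sum_long_words V0 V1 uX (N := N).
have {}h2 : (1 - th) * \sum_(w <- X) wt V w <= th ^+ N.
  by apply: h2; apply: sub_all aX => w /asboolP[].
apply: (le_trans h1); rewrite mulrC -ler_pdivlMr ?powR_gt0//.
have th1 : 0 < 1 - th by rewrite subr_gt0.
rewrite -(ler_pM2l th1) (le_trans h2)// (le_trans N2)//.
by rewrite mulrCA mulrA.
Qed.

Let V (q r : R) i := if 0 < lam i then lam i `^ q * c i `^ r else 0.

Let V_ge0 q r i : 0 <= V q r i.
Proof. by rewrite /V; case: ifP => // _; rewrite mulr_ge0 ?powR_ge0. Qed.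

Let sumV q r : \sum_(i < m) V q r i = \sum_(i < m | 0 < lam i) lam i `^ q * c i `^ r.
Proof. by rewrite [RHS]big_mkcond. Qed.

Lemma lw_ge0 w : 0 <= wt lam w.
Proof. by apply: wt_ge0 => i; exact: lam_ge0 Hsys i. Qed.

Let wtV q r w : 0 < wt lam w -> wt (V q r) w = wt lam w `^ q * wt c w `^ r.
Proof.
elim: w => [|i w IH]; first by rewrite !wt_nil !powR1 mulr1.
rewrite !wt_cons => lw.
have l0 : 0 < lam i.
  have := lam_ge0 Hsys i; rewrite le_eqVlt => /orP[/eqP l0|//].
  by move: lw; rewrite -l0 mul0r ltxx.
rewrite pmulr_rgt0// in lw; rewrite IH// {1}/V l0.
by rewrite !powRM ?(ltW l0) ?(ltW lw) ?(ltW (c_gt0 _)) ?(ltW (cw_gt0 c_gt0 _))//; ring.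
Qed.

Let badV q s al w : 0 < wt lam w -> (wt c w `^ al) `^ q <= wt lam w `^ q ->
  wt c w `^ s <= wt (V q (s - al * q)) w.
Proof.
move=> lw h; rewrite wtV//; have cw := cw_gt0 c_gt0 w.
have -> : wt c w `^ s = (wt c w `^ al) `^ q * wt c w `^ (s - al * q).
  rewrite -powRrM -powRD ?(gt_eqF cw) ?implybT//.
  by congr (_ `^ _); ring.
by rewrite ler_pM2r ?powR_gt0.
Qed.

Lemma hausdorff_exponent_lt (q s al : R) : 0 <= q -> 0 < s -> 0 < al ->
  \sum_(i < m | 0 < lam i) lam i `^ q * c i `^ (s - al * q) < 1 ->
  hausdorff_measure s [set t : R | 0 < t < 1 /\ (holder_exponent f t < al%:E)%E] = 0%E.
Proof.
move=> q0 s0 al0; rewrite -sumV => V1.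
pose bad w := 0 < wt lam w /\ wt c w `^ al <= wt lam w.
apply: (hausdorff_measure_words0 s0 (V_ge0 q _) V1 (bad := bad)).
  move=> w [lw h]; apply: badV => //.
  by apply: ge0_ler_powR => //; rewrite nnegrE ?powR_ge0// ltW.
move=> t N [t01 /(holder_exponent_lt al0) nH].
have [a [D [a0 D0 HD]]] := oscillation_upper Hsys Hf.
have [a' [b [a'0 a'b b1 cab]]] := weight_bounds m_ge2 c_gt0 c_sum.
have a'1 : a' < 1 by exact: le_lt_trans b1.
(* An interval of length less than [del / a = a' ^+ N] has a word of length at least [N]. *)
pose del := a * a' ^+ N.
have del0 : 0 < del by rewrite mulr_gt0// exprn_gt0.
have dela : del <= a.
  by rewrite /del ler_piMr ?(ltW a0)// exprn_ile1// ltW.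
have dal0 : 0 < del `^ al by rewrite powR_gt0.
have C0 : 0 < 2 * D / del `^ al by rewrite divr_gt0// mulr_gt0.
(* The constant is so large that a violation forces [|z - t| < del], because no increment exceeds
   [2 * D]. *)
have [z [z01 Hz]] : exists z, 0 < z < 1 /\
    (2 * D) / del `^ al * `|z - t| `^ al < enorm (f z - f t).
  apply: contrapT => H; apply: nH; exists ((2 * D) / del `^ al) => z z01.
  by rewrite leNgt; apply/negP => Hz; apply: H; exists z.
have zt : z != t.
  apply/eqP => zt; move: Hz; rewrite zt !subrr enorm0 => /lt_geF/negP; apply.
  by rewrite mulr_ge0 ?powR_ge0// ltW.
have [v [w [_ [y y01 ty] [x x01 tx] [hv hw] HDvw]]] := HD _ _ (cl01 z01) (cl01 t01) zt.
set r := `|z - t| in hv hw Hz.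
have r0 : 0 < r by rewrite normr_gt0 subr_eq0.
have lw1 u : wt lam u <= 1.
  by apply: prodr_ile1 => i _; rewrite (lam_ge0 Hsys) ltW// (lam_lt1 Hsys).
have rdel : r < del.
  rewrite ltNge; apply/negP => dr.
  have : del `^ al <= r `^ al.
    by apply: ge0_ler_powR; rewrite ?nnegrE ?(ltW al0) ?(ltW del0) ?(ltW r0).
  rewrite -(ler_pM2l C0).
  rewrite mulfVK ?gt_eqF// => h.
  have : D * (wt lam v + wt lam w) <= 2 * D.
    by rewrite mulrC ler_pM2r//; have := lw1 v; have := lw1 w; lra.
  by lra.
have size_ge u : wt c u <= r / a -> (N <= size u)%N.
  move=> cu; rewrite leqNgt; apply/negP => uN.
  have := cw_ge u (ltW a'0) (fun i => (andP (cab i)).1).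
  apply/negP; rewrite -ltNge; apply: (le_lt_trans cu).
  rewrite ltr_pdivrMr//; apply: (lt_le_trans rdel).
  by rewrite /del mulrC ler_pM2r// ler_wiXn2l ?(ltW a'0) ?(ltW a'1) ?(ltnW uN).
have bound u : wt c u <= r / a -> wt c u `^ al <= (r / a) `^ al.
  move=> h; apply: ge0_ler_powR; rewrite ?nnegrE ?(ltW al0) ?(ltW (cw_gt0 c_gt0 u))//.
  by rewrite divr_ge0// ltW.
(* Were neither word bad, this bound would contradict the choice of [z]; it rests on [del <= a]. *)
have ra : D * (2 * (r / a) `^ al) <= 2 * D / del `^ al * r `^ al.
  rewrite powRM ?invr_ge0 ?(ltW r0) ?(ltW a0)//.
  rewrite [leLHS](_ : _ = 2 * D * a^-1 `^ al * r `^ al); last by ring.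
  rewrite ler_pM2r ?powR_gt0// ler_pM2l ?mulr_gt0//.
  rewrite -(powR_inv1 (ltW a0)) powRAC powR_inv1 ?powR_ge0//.
  rewrite lef_pV2 ?posrE ?powR_gt0//.
  by apply: ge0_ler_powR; rewrite ?nnegrE ?(ltW al0) ?(ltW del0) ?(ltW a0).
have bad_of u : wt c u `^ al <= wt lam u -> bad u.
  by move=> h; split => //; apply: lt_le_trans h; rewrite powR_gt0// cw_gt0.
case/andP: hv => _ hv; case/andP: hw => _ hw.
have [hbv|hbv] := leP (wt c v `^ al) (wt lam v).
  by exists v; split; [exact: size_ge|exact: bad_of|exists y].
have [hbw|hbw] := leP (wt c w `^ al) (wt lam w).
  exists w; split; [exact: size_ge|exact: bad_of|exists x => //].
  by rewrite -tx subrr normr0 ltW// cw_gt0.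
have := bound _ hv; have := bound _ hw => h1 h2; exfalso.
have : D * (wt lam v + wt lam w) <= D * (2 * (r / a) `^ al).
  by rewrite ler_pM2l//; lra.
by lra.
Qed.

Lemma positive_word (t : R) n : 0 < t < 1 -> (holder_exponent f t < +oo)%E ->
  exists w, [/\ size w = n, 0 < wt lam w & exists2 x : R, 0 <= x <= 1 & t = Phi w x].
Proof.
move=> t01 et; apply: contrapT => H; move: et.
rewrite (@holder_exponent_pinfty _ _ f t) ?ltxx// => a a0.
apply: (flat_in_holder Hsys Hf (n := n)) => // w x wn x01 tx; apply/eqP.
rewrite eq_le lw_ge0 andbT leNgt; apply/negP => lw; apply: H.
by exists w; split => //; exists x.
Qed.

Lemma hausdorff_exponent_gt (q s al : R) : q <= 0 -> 0 < s -> 0 <= al ->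
  \sum_(i < m | 0 < lam i) lam i `^ q * c i `^ (s - al * q) < 1 ->
  hausdorff_measure s
    [set t : R | 0 < t < 1 /\ (al%:E < holder_exponent f t < +oo)%E] = 0%E.
Proof.
move=> q0 s0 al0; rewrite -sumV => V1.
pose bad w := 0 < wt lam w /\ wt lam w <= wt c w `^ al.
apply: (hausdorff_measure_words0 s0 (V_ge0 q _) V1 (bad := bad)).
  move=> w [lw h]; apply: badV => //.
  have cal : 0 < wt c w `^ al by rewrite powR_gt0// cw_gt0.
  have : 0 <= - q by rewrite oppr_ge0.
  rewrite -[in wt c w `^ al `^ q](opprK q) -[in wt lam w `^ q](opprK q).
  move: (- q) => p p0; rewrite !powRN lef_pV2 ?posrE ?powR_gt0 ?(cw_gt0 c_gt0)//.
  by apply: ge0_ler_powR; rewrite ?nnegrE ?(ltW lw) ?(ltW cal).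
move=> t N [t01 /andP[/(holder_exponent_gt al0)[al' al'al Ht] et]].
have [K K0 HK] := in_holder_word Hsys Hf (le_trans al0 (ltW al'al)) Ht.
have [a [b [a0 ab b1 cab]]] := weight_bounds m_ge2 c_gt0 c_sum.
have b0 : 0 < b by exact: lt_le_trans ab.
pose be := b `^ (al' - al).
have be0 : 0 <= be by exact: powR_ge0.
have be1 : be < 1.
  have -> : 1 = 1 `^ (al' - al) :> R by rewrite powR1.
  by apply: gt0_ltr_powR; rewrite ?nnegrE ?subr_gt0// ltW.
have [n Nn hn] : exists2 n, (N <= n)%N & be ^+ n <= K^-1.
  have /cvgrPdist_le/(_ K^-1) := cvg_expr (ltac:(by rewrite ger0_norm) : `|be| < 1).
  rewrite invr_gt0 => /(_ K0)[n0 _ H]; exists (maxn N n0); first exact: leq_maxl.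
  have := H (maxn N n0) (leq_maxr _ _).
  by rewrite /= sub0r normrN ger0_norm// exprn_ge0.
have [w [wn lw [x x01 tx]]] := positive_word n t01 et.
exists w; split; [by rewrite wn| |by exists x; rewrite // -tx subrr normr0 ltW// cw_gt0].
split => //; apply: (le_trans (HK w x x01 tx)).
have cw := cw_gt0 c_gt0 w.
have -> : al' = al + (al' - al) by ring.
rewrite powRD ?(gt_eqF cw) ?implybT// mulrCA ler_piMr ?powR_ge0//.
have K'0 : 0 < K^-1 by rewrite invr_gt0.
rewrite -(ler_pM2l K'0) mulrA mulVf ?gt_eqF// mul1r mulr1.
apply: le_trans hn; rewrite /be -powR_mulrn ?powR_ge0// -!powRrM.
have -> : (al' - al) * n%:R = n%:R * (al' - al) by rewrite mulrC.
rewrite powRrM powR_mulrn ?(ltW b0)//.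
apply: ge0_ler_powR; rewrite ?nnegrE ?subr_ge0 ?(ltW al'al) ?(ltW cw) ?exprn_ge0 ?(ltW b0)//.
by rewrite -wn; apply: (cw_le c_gt0) => i; case/andP: (cab i).
Qed.

(** The gap between [s] and [s'] pays both for the strict inequality and for moving [al] by a small
    [e], upwards or downwards according to the sign of [q]. *)
Lemma hausdorff_level_set0 (q s s' al : R) : s < s' -> 0 < s' -> 0 < al ->
  \sum_(i < m | 0 < lam i) lam i `^ q * c i `^ (s - al * q) <= 1 ->
  hausdorff_measure s' (level_set f al%:E) = 0%E.
Proof.
move=> ss' s'0 al0 H.
pose e := Num.min (al / 2) ((s' - s) / (2 * (`|q| + 1))).
have q1 : 0 < `|q| + 1 by rewrite ltr_wpDl.
have e0 : 0 < e by rewrite lt_min !divr_gt0 ?mulr_gt0 ?subr_gt0.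
have eal : e <= al / 2 by rewrite ge_min lexx.
have eq : e * `|q| < s' - s.
  have : e <= (s' - s) / (2 * (`|q| + 1)) by rewrite ge_min lexx orbT.
  rewrite ler_pdivlMr ?mulr_gt0// => h; have := normr_ge0 q; nra.
have lt1 al' : al' * q <= al * q + e * `|q| ->
    \sum_(i < m | 0 < lam i) lam i `^ q * c i `^ (s' - al' * q) < 1.
  move=> h; apply: lt_le_trans H.
  have [i0 [_ [_ l0 _]]] := two_positive_ratios Hsys Hf.
  rewrite (bigD1 i0)//= [ltRHS](bigD1 i0)//=.
  have lt i : c i `^ (s' - al' * q) < c i `^ (s - al * q).
    have ci1 := c_lt1 Hsys i; have ci0 := c_gt0 i.
    by apply: ltr_powR; rewrite ?ci0 ?ci1//; lra.
  apply: ltr_leD; first by rewrite ltr_pM2l ?powR_gt0.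
  by apply: ler_sum => i /andP[li _]; rewrite ler_pM2l ?powR_gt0// ltW.
have [q0|q0] := leP 0 q.
  apply: hausdorff_measure_sub0 (hausdorff_exponent_lt q0 s'0 (addr_gt0 al0 e0) _).
    by move=> t [t01 et]; split => //; rewrite et lte_fin ltrDl.
  by apply: lt1; rewrite ger0_norm//; lra.
have ale : 0 <= al - e by lra.
apply: hausdorff_measure_sub0 (hausdorff_exponent_gt (ltW q0) s'0 ale _).
  by move=> t [t01 et]; split => //; rewrite et lte_fin ltry andbT; lra.
by apply: lt1; rewrite ltr0_norm//; lra.
Qed.

End upper_bound.

(** * Cantor subsets of the level sets *)

(** Consecutive half-open cells of lengths [p v] tile the interval; they serve as digits in the
    coding of the Cantor set. *)
Lemma subdivision (R : realType) (T : eqType) (L : seq T) (p : T -> R) : uniq L ->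
  (forall v, v \in L -> 0 < p v) ->
  exists off : T -> R, forall y, 0 <= y < \sum_(v <- L) p v ->
    exists2 v, v \in L & off v <= y < off v + p v.
Proof.
elim: L => [|u L IH] /=.
  by exists (fun=> 0) => y; rewrite big_nil => /andP[y0 /(le_lt_trans y0)]; rewrite ltxx.
move=> /andP[uL uniqL] p0; have [|off Hoff] := IH uniqL.
  by move=> v vL; apply: p0; rewrite inE vL orbT.
exists (fun v => if v == u then 0 else p u + off v) => y.
rewrite big_cons => /andP[y0 yp]; have [yu|uy] := ltP y (p u).
  by exists u; rewrite ?inE eqxx// add0r y0.
have [|v vL vy] := Hoff (y - p u); first by lra.
exists v; first by rewrite inE vL orbT.
by rewrite ifF; [lra|apply: contraNF uL => /eqP <-].
Qed.

Section nested.
Variables (R : realType) (m : nat) (eps : 'I_m -> bool) (c : 'I_m -> R).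
Hypotheses (m_ge2 : (2 <= m)%N) (c_gt0 : forall i, 0 < c i).
Hypothesis c_sum : \sum_(i < m) c i = 1.
Local Notation Phi := (word_map eps c).

Lemma Phi_between w (y : R) : 0 <= y <= 1 ->
  Num.min (Phi w 0) (Phi w 1) <= Phi w y <= Num.max (Phi w 0) (Phi w 1).
Proof.
move=> y01; have h1 := Phi_sub eps c w y 0; have h2 := Phi_sub eps c w 1 0.
rewrite subr0 in h1; rewrite subr0 mulr1 in h2.
rewrite ge_min le_max; have [s0|s0] := leP 0 (slope eps c w).
  by apply/andP; split; apply/orP; [left; nra|right; nra].
by apply/andP; split; apply/orP; [right; nra|left; nra].
Qed.

(** The point is the supremum of the left ends. Which image is the left end depends on the
    orientation of the word, hence the minima and maxima. *)
Lemma nested_words (U v : nat -> seq 'I_m) : (forall n, U n.+1 = U n ++ v n) ->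
  exists t : R, forall n, exists2 x : R, 0 <= x <= 1 & t = Phi (U n) x.
Proof.
move=> UE; pose lo n := Num.min (Phi (U n) 0) (Phi (U n) 1).
pose hi n := Num.max (Phi (U n) 0) (Phi (U n) 1).
have i0 : 0 <= (0 : R) <= 1 by rewrite lexx ler01.
have i1 : 0 <= (1 : R) <= 1 by rewrite lexx ler01.
have step n e : 0 <= e <= 1 -> lo n <= Phi (U n.+1) e <= hi n.
  by move=> e01; rewrite UE Phi_cat; apply: Phi_between; exact: Phi01.
have loS n : lo n <= lo n.+1.
  by rewrite [leRHS]/lo le_min; case/andP: (step n 0 i0) => ->; case/andP: (step n 1 i1) => ->.
have hiS n : hi n.+1 <= hi n.
  by rewrite [leLHS]/hi ge_max; case/andP: (step n 0 i0) => _ ->; case/andP: (step n 1 i1) => _ ->.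
have lohi n : lo n <= hi n by have /andP[] := Phi_between (U n) i0; exact: le_trans.
have lo_le n k : (n <= k)%N -> lo n <= lo k by move: n k; apply/nondecreasing_seqP.
have hi_le n k : (n <= k)%N -> hi k <= hi n.
  by move: n k; apply/nonincreasing_seqP.
have lh n k : lo n <= hi k.
  apply: (le_trans (lo_le _ _ (leq_maxl n k))); apply: (le_trans (lohi _)).
  exact: hi_le (leq_maxr n k).
exists (sup (range lo)) => n; set t := sup _.
have lt : lo n <= t.
  by apply: ub_le_sup; [exists (hi 0%N) => _ [k _ <-]|exists n].
have th : t <= hi n.
  by apply: ge_sup; [exists (lo 0%N); exists 0%N|move=> _ [k _ <-]].
have [x tx] := Phi_surj eps c_gt0 (U n) t; exists x => //.
have h1 := Phi_sub eps c (U n) x 0; have h2 := Phi_sub eps c (U n) 1 0.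
rewrite -tx subr0 in h1; rewrite subr0 mulr1 in h2.
have s0 : slope eps c (U n) != 0 by rewrite -normr_gt0 slope_norm// cw_gt0.
move: lt th; rewrite /lo /hi ge_min le_max.
move: s0; rewrite neq_lt => /orP[s0|s0] /orP[l|l] /orP[h|h]; nra.
Qed.

End nested.

(** * A Cantor set coded by the unit interval *)

Section cantor_construction.
Variables (R : realType) (d m : nat) (eps : 'I_m -> bool).
Variables (S : 'I_m -> 'rV[R]_d -> 'rV[R]_d) (lam c : 'I_m -> R).
Variable f : R -> 'rV[R]_d.
Hypothesis Hsys : self_affine_system eps lam c S.
Hypothesis Hf : self_affine_function eps c S f.

Let m_ge2 := sas_size Hsys.
Let c_gt0 := sas_weight Hsys.
Let c_sum := sas_weight_sum Hsys.

Local Notation Phi := (word_map eps c).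

Variable al : R.
Hypothesis al_gt0 : 0 < al.

(* [discrepancy w] measures how far the pair of weights of [w] is from satisfying
   [wt lam w = wt c w `^ al]. *)
Definition discrepancy (w : seq 'I_m) : R := \sum_(i <- w) (ln (lam i) - al * ln (c i)).

Local Notation disc := discrepancy.

Lemma disc_cat v w : disc (v ++ w) = disc v + disc w.
Proof. exact: big_cat. Qed.

Lemma lw_disc w : all (fun i => 0 < lam i) w ->
  wt lam w = expR (disc w) * wt c w `^ al.
Proof.
rewrite /discrepancy; elim: w => [|i w IH] /=.
  by rewrite !wt_nil big_nil expR0 powR1 mulr1.
move=> /andP[li aw]; rewrite !wt_cons big_cons IH// expRD powRM ?ltW ?cw_gt0//.
have -> : c i `^ al = expR (al * ln (c i)) by rewrite /powR gt_eqF.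
have e0 : expR (al * ln (c i)) != 0 by rewrite gt_eqF// expR_gt0.
by rewrite expRB lnK ?posrE//; move: e0; move: (expR _) => e e0; field.
Qed.

(** [B true] holds the blocks that raise the discrepancy and is used when the current value is at
    most 0; [B false] holds those that lower it. The probabilities [p] satisfy a mass bound of
    exponent [s], and [kap] is a uniform margin for positions, separations and lengths. *)
Variables (s kap M : R) (B : bool -> seq (seq 'I_m)) (p : bool -> seq 'I_m -> R).
Hypotheses (s_gt0 : 0 < s) (kap_gt0 : 0 < kap).
Hypothesis B_uniq : forall b, uniq (B b).
Hypothesis B_pos : forall b (v : seq 'I_m), v \in B b -> all (fun i => 0 < lam i) v.
Hypothesis p_gt0 : forall b (v : seq 'I_m), v \in B b -> 0 < p b v.
Hypothesis p_sum : forall b, \sum_(v <- B b) p b v = 1.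
Hypothesis p_le : forall b (v : seq 'I_m), v \in B b -> p b v <= wt c v `^ s.
Hypothesis B_disc : forall b (v : seq 'I_m), v \in B b ->
  if b then 0 <= disc v <= M else - M <= disc v <= 0.
Hypothesis B_inside : forall b (v : seq 'I_m) (x : R), v \in B b -> 0 <= x <= 1 ->
  kap <= Phi v x <= 1 - kap.
Hypothesis B_sep : forall b (v w : seq 'I_m) (x y : R), v \in B b -> w \in B b -> v != w ->
  0 <= x <= 1 -> 0 <= y <= 1 -> kap <= `|Phi v x - Phi w y|.
Hypothesis B_size : forall b (v : seq 'I_m), v \in B b -> kap <= wt c v.

Let sgn w := disc w <= 0.

Let step : {offnxt : (bool -> seq 'I_m -> R) * (bool -> R -> seq 'I_m) |
  forall b y, 0 <= y < 1 -> offnxt.2 b y \in B b /\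
    offnxt.1 b (offnxt.2 b y) <= y < offnxt.1 b (offnxt.2 b y) + p b (offnxt.2 b y)}.
Proof.
apply: cid.
have [off Hoff] := choice (fun b => subdivision (B_uniq b) (@p_gt0 b)).
have H (by' : bool * R) : exists v, 0 <= by'.2 < 1 -> v \in B by'.1 /\
    off by'.1 v <= by'.2 < off by'.1 v + p by'.1 v.
  case: by' => b y /=; have [y01|ny] := boolP (0 <= y < 1); last by exists [::].
  by have [|v vB vy] := Hoff b y; rewrite ?p_sum//; exists v.
have [nxt Hnxt] := choice H; exists (off, fun b y => nxt (b, y)) => b y y01 /=.
exact: (Hnxt (b, y) y01).
Qed.

Let off := (sval step).1.
Let nxt := (sval step).2.

(** An expansion of [y] with blocks as digits: the word read so far, and the position of [y] in its
    current cell, rescaled to [[0, 1)]. *)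
Fixpoint cantor_state (y : R) n : seq 'I_m * R :=
  if n is n'.+1 then
    let: (w, z) := cantor_state y n' in
    let v := nxt (sgn w) z in
    (w ++ v, (z - off (sgn w) v) / p (sgn w) v)
  else ([::], y).

Let W y n := (cantor_state y n).1.
Let Z y n := (cantor_state y n).2.
Let v y n := nxt (sgn (W y n)) (Z y n).

Let WS y n : W y n.+1 = W y n ++ v y n.
Proof. by rewrite /W /v /W /Z /=; case: cantor_state. Qed.

Let ZS y n : Z y n.+1 = (Z y n - off (sgn (W y n)) (v y n)) / p (sgn (W y n)) (v y n).
Proof. by rewrite /Z /v /W /Z /=; case: cantor_state. Qed.

Let stepP (y : R) n : 0 <= Z y n < 1 -> v y n \in B (sgn (W y n)) /\
  off (sgn (W y n)) (v y n) <= Z y n <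
    off (sgn (W y n)) (v y n) + p (sgn (W y n)) (v y n).
Proof. exact: (svalP step). Qed.

Let Z01 (y : R) n : 0 <= y < 1 -> 0 <= Z y n < 1.
Proof.
move=> y01; elim: n => // n IH; have [vB /andP[h1 h2]] := stepP IH.
have p0 := p_gt0 vB; rewrite ZS divr_ge0 ?subr_ge0 ?(ltW p0)//=.
by rewrite ltr_pdivrMr// mul1r ltrBlDl.
Qed.

Let vB (y : R) n : 0 <= y < 1 -> v y n \in B (sgn (W y n)).
Proof. by move=> y01; case: (stepP (Z01 n y01)). Qed.

Let W_pos (y : R) n : 0 <= y < 1 -> all (fun i => 0 < lam i) (W y n).
Proof.
move=> y01; elim: n => // n IH; rewrite WS all_cat IH/=.
exact: B_pos (vB n y01).
Qed.

(** Each block moves the discrepancy by at most [M], away from the sign it has, so it never leaves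
    [[- M, M]]. *)
Let W_disc (y : R) n : 0 <= y < 1 -> - M <= disc (W y n) <= M.
Proof.
move=> y01; elim: n => [|n IH].
  rewrite /W /= /discrepancy big_nil; have := B_disc (vB 0 y01).
  by case: ifP => _; lra.
rewrite WS disc_cat; have := B_disc (vB n y01); rewrite /sgn.
by case: leP => dW; lra.
Qed.

Let kap_lt1 (y : R) : 0 <= y < 1 -> kap <= 1 / 2.
Proof.
move=> y01; have := B_inside (x := 0) (vB 0 y01); rewrite lexx ler01 => /(_ isT).
lra.
Qed.

Let cW_le (y : R) : 0 <= y < 1 -> exists2 b : R, 0 <= b < 1 & forall n, wt c (W y n) <= b ^+ n.
Proof.
move=> y01; have [a [b [a0 ab b1 cab]]] := weight_bounds m_ge2 c_gt0 c_sum.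
have b0 : 0 <= b by apply: le_trans ab; exact: ltW.
exists b => [|k]; first by rewrite b0.
have cb i : c i <= b by case/andP: (cab i).
elim: k => [|k IH]; first by rewrite /W/= wt_nil.
rewrite WS wt_cat exprSr; apply: ler_pM => //; try exact: ltW (cw_gt0 c_gt0 _).
(* Blocks are nonempty, since the empty word sends 0 to 0, outside [[kap, 1 - kap]]; each block thus
   shortens the interval by a factor at most [b]. *)
have := B_inside (x := 0) (vB k y01); rewrite lexx ler01 => /(_ isT).
case: (v y k) => [|i w _]; first by rewrite /word_map /=; have := kap_gt0; lra.
rewrite wt_cons -[leRHS]mulr1; apply: ler_pM => //; try exact: ltW (cw_gt0 c_gt0 _).
  exact: ltW (c_gt0 i).
by apply: prodr_ile1 => j _; rewrite ltW ?(ltW (c_lt1 Hsys j)).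
Qed.

Let cW_small (y e : R) : 0 <= y < 1 -> 0 < e -> exists n, wt c (W y n) < e.
Proof.
move=> y01 e0; have [b /andP[b0 b1] Hb] := cW_le y01.
have /cvgrPdist_lt/(_ e e0)[n _ /(_ n (leqnn n))] :=
  cvg_expr (ltac:(by rewrite ger0_norm) : `|b| < 1).
rewrite /= sub0r normrN ger0_norm ?exprn_ge0// => h.
by exists n; exact: le_lt_trans h.
Qed.

(** Parameters with the same first [n] blocks lie in a cell whose length is a product of values of
    [p], and [p_le] compares it with the [s]-th power of the interval length. *)
Let agree (y y' : R) n : 0 <= y < 1 -> 0 <= y' < 1 ->
  (forall k, (k < n)%N -> v y k = v y' k) ->
  W y n = W y' n /\ `|y - y'| <= wt c (W y n) `^ s * `|Z y n - Z y' n|.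
Proof.
move=> y01 y'01; elim: n => [|n IH] H; first by rewrite /W wt_nil powR1 mul1r.
have [|WE yy] := IH; first by move=> k kn; apply: H; exact: ltnW.
have vE := H n (ltnSn n); split; first by rewrite !WS WE vE.
apply: (le_trans yy).
have zE x : 0 <= x < 1 -> Z x n = off (sgn (W x n)) (v x n) +
    p (sgn (W x n)) (v x n) * Z x n.+1.
  move=> x01; rewrite ZS [_ * (_ / _)]mulrC divfK ?gt_eqF ?p_gt0 ?vB//; ring.
have vb := vB n y01; have p0 := p_gt0 vb.
rewrite (zE y y01) (zE y' y'01) -vE -WE opprD addrACA subrr add0r -mulrBr.
rewrite normrM gtr0_norm// WS wt_cat powRM; try exact: ltW (cw_gt0 c_gt0 _).
by rewrite -mulrA ler_wpM2l ?powR_ge0// ler_wpM2r//; exact: p_le.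
Qed.

Let h_ex y : exists t : R, forall n, exists2 x : R, 0 <= x <= 1 & t = Phi (W y n) x.
Proof. exact: (nested_words eps c_gt0 c_sum (WS y)). Qed.

Let h y := sval (cid (h_ex y)).

Let hP y n : exists2 x : R, 0 <= x <= 1 & h y = Phi (W y n) x.
Proof. exact: (svalP (cid (h_ex y))). Qed.

Let h_block y n : exists2 x : R, 0 <= x <= 1 & h y = Phi (W y n) (Phi (v y n) x).
Proof. by have [x x01 hx] := hP y n.+1; exists x; rewrite // hx WS Phi_cat. Qed.

(** At the first block where the codings differ, the points are at least [kap] times the current
    interval apart, whereas the parameters still share a cell. *)
Lemma cantor_separation : exists2 C : R, 0 < C &
  forall y y' : R, 0 <= y < 1 -> 0 <= y' < 1 -> `|y - y'| <= C * `|h y - h y'| `^ s.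
Proof.
exists (kap^-1 `^ s) => [|y y' y01 y'01]; first by rewrite powR_gt0// invr_gt0.
have [->|yy'] := eqVneq y y'.
  by rewrite !subrr normr0 mulr_ge0 ?powR_ge0.
have ex : exists n, v y n != v y' n.
  apply: contrapT => H.
  have vE n : v y n = v y' n by apply/eqP/negPn/negP => nv; apply: H; exists n.
  have yy0 : 0 < `|y - y'| `^ s^-1 by rewrite powR_gt0// normr_gt0 subr_eq0.
  have [n hn] := cW_small y01 yy0.
  have [_] := agree y01 y'01 (n := n) (fun k _ => vE k).
  apply/negP; rewrite -ltNge; apply: (@le_lt_trans _ _ (wt c (W y n) `^ s)).
    rewrite ler_piMr ?powR_ge0//; have := Z01 n y01; have := Z01 n y'01.
    by rewrite ler_norml; lra.
  have : wt c (W y n) `^ s < (`|y - y'| `^ s^-1) `^ s.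
    by apply: gt0_ltr_powR; rewrite ?nnegrE ?powR_ge0 ?(ltW (cw_gt0 c_gt0 _)).
  by rewrite -powRrM mulVf ?gt_eqF// powRr1.
case: (ex_minnP ex) => n vn minn.
have [|WE yy] := agree y01 y'01 (n := n).
  by move=> k kn; apply/eqP/negPn/negP => /minn; rewrite leqNgt kn.
have cW0 := cw_gt0 c_gt0 (W y n).
have hh : wt c (W y n) * kap <= `|h y - h y'|.
  have [x x01 ->] := h_block y n; have [x' x'01 ->] := h_block y' n.
  rewrite -WE Phi_dist// ler_pM2l//.
  have vb := vB n y01; have := vB n y'01; rewrite -WE => vb'.
  exact: (B_sep vb vb' vn).
apply: (le_trans yy); apply: (@le_trans _ _ (wt c (W y n) `^ s)).
  rewrite ler_piMr ?powR_ge0//; have := Z01 n y01; have := Z01 n y'01.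
  by rewrite ler_norml; lra.
rewrite -powRM ?invr_ge0 ?(ltW kap_gt0)//.
apply: ge0_ler_powR; rewrite ?nnegrE ?mulr_ge0 ?invr_ge0 ?(ltW kap_gt0) ?(ltW s_gt0) ?(ltW cW0)//.
by rewrite mulrC ler_pdivlMr.
Qed.

Let lW (y : R) n : 0 <= y < 1 -> wt lam (W y n) = expR (disc (W y n)) * wt c (W y n) `^ al.
Proof. by move=> y01; exact: lw_disc (W_pos n y01). Qed.

Lemma cantor_level_set (y : R) : 0 <= y < 1 -> level_set f al%:E (h y).
Proof.
move=> y01; have k0 := kap_gt0; have k2 := kap_lt1 y01.
have h01 : 0 < h y < 1.
  have [x x01 ->] := h_block y 0; have := B_inside (vB 0 y01) x01.
  by rewrite /W /= /word_map /=; lra.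
have cl (z : R) : 0 < z < 1 -> 0 <= z <= 1 by move=> /andP[/ltW -> /ltW ->].
split => //; apply/eqP; rewrite eq_le; apply/andP; split.
  apply: holder_exponent_le; first exact: ltW al_gt0.
  move=> al' al'al Hal'.
  have [K K0 HK] := in_holder_word Hsys Hf (ltW (lt_trans al_gt0 al'al)) Hal'.
  (* Below this length, [K * wt c w]^ al'[drops under]expR (- M) * wt c w [^ al], which bounds
     [wt lam w] from below for the words coding [h y]. *)
  pose e := (expR (- M) / K) `^ (al' - al)^-1.
  have d0 : 0 < al' - al by rewrite subr_gt0.
  have e0 : 0 < e by rewrite powR_gt0// divr_gt0// expR_gt0.
  have [n hn] := cW_small y01 e0; have cW0 := cw_gt0 c_gt0 (W y n).
  have [x x01 hx] := hP y n; have := HK (W y n) x x01 hx.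
  apply/negP; rewrite -ltNge lW//.
  have -> : al' = al + (al' - al) by ring.
  rewrite powRD ?(gt_eqF cW0) ?implybT// mulrCA [ltRHS]mulrC ltr_pM2l ?powR_gt0//.
  apply: (@lt_le_trans _ _ (expR (- M))); last first.
    by rewrite ler_expR; case/andP: (W_disc n y01).
  rewrite mulrC -ltr_pdivlMr//.
  have : wt c (W y n) `^ (al' - al) < e `^ (al' - al).
    by apply: gt0_ltr_powR; rewrite ?nnegrE ?(ltW e0) ?(ltW cW0).
  by rewrite /e -powRrM mulVf ?gt_eqF// powRr1// divr_ge0 ?expR_ge0// ltW.
apply: holder_exponent_ge => //; have [D D0 HD] := f_bounded Hf.
(* The factor [expR M] bounds the discrepancy. One factor [kap] accounts for the length of a block,
   the other for the depth of [h y] inside the first interval that misses [z]. *)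
exists (D * expR M * (kap ^- 2) `^ al) => z z01.
have [->|zt] := eqVneq z (h y).
  by rewrite !subrr enorm0 !mulr_ge0 ?powR_ge0 ?expR_ge0// ltW.
have ex : exists n, ~~ `[< exists2 x : R, 0 <= x <= 1 & z = Phi (W y n) x >].
  apply: contrapT => H.
  have d0 : 0 < `|z - h y| by rewrite normr_gt0 subr_eq0.
  have [n hn] := cW_small y01 d0.
  have : `[< exists2 x : R, 0 <= x <= 1 & z = Phi (W y n) x >].
    by apply/negPn/negP => nz; apply: H; exists n.
  move=> /asboolP[x x01 zx]; have [x' x'01 hx'] := hP y n.
  move: hn; rewrite zx hx' Phi_dist// ltr_pMr ?cw_gt0//.
  by apply/negP; rewrite -leNgt ler_norml; lra.
case: (ex_minnP ex) => -[/asboolP[]|n /asboolP zn minn].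
  by exists z; [exact: cl|rewrite /W].
have /asboolP[x x01 zx] : `[< exists2 x : R, 0 <= x <= 1 & z = Phi (W y n) x >].
  by apply/negPn/negP => /minn; rewrite ltnn.
have [x' x'01 hx'] := hP y n.
have cW0 := cw_gt0 c_gt0 (W y n).
have fz : enorm (f z - f (h y)) <= D * expR M * wt c (W y n) `^ al.
  rewrite zx hx' (f_Phi_dist Hsys Hf)// lW// [leLHS]mulrC -mulrA.
  apply: ler_pM => //; rewrite ?enorm_ge0 ?HD// ?mulr_ge0 ?expR_ge0 ?powR_ge0//.
  by rewrite ler_wpM2r ?powR_ge0// ler_expR; case/andP: (W_disc n y01).
have zh : wt c (W y n) * kap ^+ 2 <= `|z - h y|.
  have [x1 x1p hx1] := h_block y n.+1.
  have [z1 zz1] := Phi_surj eps c_gt0 (W y n.+1) z.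
  have nz1 : ~ (0 < z1 < 1) by move=> /cl z101; apply: zn; exists z1.
  rewrite distrC hx1 zz1.
  apply: le_trans (Phi_outside eps c_gt0 _ (B_inside (vB n.+1 y01) x1p) nz1).
  rewrite expr2 mulrA ler_pM2r// WS wt_cat ler_pM2l//.
  exact: B_size (vB n y01).
apply: (le_trans fz); rewrite -[leRHS]mulrA ler_wpM2l ?mulr_ge0 ?expR_ge0 ?(ltW D0)//.
rewrite -powRM ?invr_ge0 ?exprn_ge0 ?(ltW k0)//.
apply: ge0_ler_powR; rewrite ?nnegrE ?(ltW al_gt0) ?(ltW cW0)//.
  by rewrite mulr_ge0 ?invr_ge0 ?exprn_ge0 ?(ltW k0).
by rewrite mulrC ler_pdivlMr// exprn_gt0.
Qed.

Lemma cantor_dim : (s%:E <= hausdorff_dim (level_set f al%:E))%E.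
Proof.
have [C C0 HC] := cantor_separation.
exact: (hausdorff_dim_ge C0 (ltW s_gt0) cantor_level_set HC).
Qed.

End cantor_construction.

(** * Cramer's lower bound for sums over words *)

Section exponential_growth.
Variables (R : realType) (m : nat).
Implicit Types (Q : seq 'I_m) (b a z p : 'I_m -> R) (w : seq 'I_m).

Definition asum a w : R := \sum_(i <- w) a i.

Lemma wt_tilt b a (q : R) w :
  wt (fun i => b i * expR (q * a i)) w = wt b w * expR (q * asum a w).
Proof.
rewrite /wt /asum big_split; congr (_ * _).
by rewrite mulr_sumr -expR_sum.
Qed.

(** From [expR (- x) >= 1 - x] one gets [expR x <= 1 / (1 - x)], and [(1 + x + 2 * x ^+ 2) * (1 - x)
    = 1 + x ^+ 2 * (1 - 2 * x)]. *)
Lemma expR_quadratic (x : R) : x <= 1 / 2 -> expR x <= 1 + x + 2 * x ^+ 2.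
Proof.
move=> x2; have h := expR_ge1Dx (- x); have := expRxMexpNx_1 x.
have := expR_gt0 x; have : 0 <= x ^+ 2 * (1 - 2 * x) by rewrite mulr_ge0 ?sqr_ge0//; lra.
move: (expR x) (expR (- x)) h => e e' h h2 e0 ee.
have ex : e * (1 - x) <= 1 by have := ler_wpM2l (ltW e0) h; rewrite ee.
have x1 : 0 < 1 - x by lra.
rewrite -(ler_pM2r x1); apply: (le_trans ex).
have -> : (1 + x + 2 * x ^+ 2) * (1 - x) = 1 + x ^+ 2 * (1 - 2 * x) by ring.
by lra.
Qed.

Lemma negative_drift Q p z : (forall i, 0 <= p i) -> \sum_(i <- Q) p i = 1 ->
  \sum_(i <- Q) p i * z i < 0 ->
  exists2 t : R, 0 < t & \sum_(i <- Q) p i * expR (t * z i) < 1.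
Proof.
move=> p0 p1 mu0; set mu := \sum_(i <- Q) _ in mu0.
pose v := \sum_(i <- Q) p i * z i ^+ 2; pose s := \sum_(i < m) `|z i|.
have v0 : 0 <= v by apply: sumr_ge0 => i _; rewrite mulr_ge0 ?sqr_ge0.
have s0 : 0 <= s by exact: sumr_ge0.
have zs i : z i <= s.
  apply: (le_trans (ler_norm _)); rewrite /s (bigD1 i)//= lerDl; exact: sumr_ge0.
(* The first term makes [expR_quadratic] applicable; the second keeps the quadratic term below half
   of the drift [t * mu] in absolute value. *)
pose t := Num.min (1 / (2 * (s + 1))) (- mu / (4 * (v + 1))).
have t0 : 0 < t by rewrite lt_min !divr_gt0 ?mulr_gt0 ?oppr_gt0//; lra.
have ts : t * (s + 1) <= 1 / 2.
  have : t <= 1 / (2 * (s + 1)) by rewrite ge_min lexx.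
  by rewrite ler_pdivlMr ?mulr_gt0//; lra.
have tv : t * (4 * (v + 1)) <= - mu.
  have : t <= - mu / (4 * (v + 1)) by rewrite ge_min lexx orbT.
  by rewrite ler_pdivlMr// mulr_gt0//; lra.
exists t => //; apply: (@le_lt_trans _ _ (1 + t * mu + 2 * t ^+ 2 * v)); last nra.
rewrite -[X in X + _ + _]p1 /mu /v !mulr_sumr -!big_split/=; apply: ler_sum => i _.
have tz : t * z i <= 1 / 2.
  by apply: le_trans ts; rewrite ler_pM2l//; have := zs i; lra.
apply: (le_trans (ler_wpM2l (p0 i) (expR_quadratic tz))).
by rewrite le_eqVlt; apply/orP; left; apply/eqP; ring.
Qed.

(* Chernoff's bound *)
Lemma words_tail Q p z : (forall i, 0 <= p i) -> \sum_(i <- Q) p i = 1 ->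
  \sum_(i <- Q) p i * z i < 0 ->
  exists2 r : R, 0 <= r < 1 &
    forall n, \sum_(w <- words Q n | 0 <= asum z w) wt p w <= r ^+ n.
Proof.
move=> p0 p1 mu0; have [t t0 r1] := negative_drift p0 p1 mu0.
exists (\sum_(i <- Q) p i * expR (t * z i)).
  by rewrite r1 andbT; apply: sumr_ge0 => i _; rewrite mulr_ge0// expR_ge0.
move=> n; rewrite -sum_words big_mkcond/=; apply: ler_sum => w _.
rewrite wt_tilt; have w0 : 0 <= wt p w by exact: wt_ge0.
case: ifPn => [zw|_]; last by rewrite mulr_ge0// expR_ge0.
rewrite ler_peMr//; apply: le_trans (expR_ge1Dx _).
by rewrite lerDl mulr_ge0// ltW.
Qed.

Let F Q b a (q : R) := \sum_(i <- Q) b i * expR (q * a i).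

Let continuous_F Q b a : continuous (F Q b a).
Proof.
elim: Q => [|i Q IH] q.
  rewrite [F _ _ _](_ : _ = fun=> 0); first exact: cst_continuous.
  by apply/funext => x; rewrite /F big_nil.
rewrite [F _ _ _](_ : _ = (fun x => b i * expR (x * a i) + F Q b a x)).
  apply: cvgD; last exact: IH.
  apply: cvgMr; apply: continuous_cvg; first exact: continuous_expR.
  by apply: cvgMl; exact: cvg_id.
by apply/funext => x; rewrite /F big_cons.
Qed.

(** For large [q] the term of a letter with [a i > 0] outweighs all negative terms, which stay
    bounded for [q >= 0]. *)
Let drift_ge0 Q b a i : uniq Q -> (forall j, 0 < b j) -> i \in Q -> 0 < a i ->
  exists q : R, 0 <= F Q (fun j => b j * a j) a q.
Proof.
move=> uQ b0 iQ ai; pose s := \sum_(j <- Q) `|b j * a j|.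
have s0 : 0 <= s by exact: sumr_ge0.
have ba : 0 < b i * a i * a i by rewrite !mulr_gt0.
pose q := s / (b i * a i * a i); have q0 : 0 <= q by rewrite divr_ge0// ltW.
have qs : b i * a i * a i * q = s by rewrite mulrC divfK// gt_eqF.
exists q; rewrite /F (bigD1_seq i)//=.
have hi : s <= b i * a i * expR (q * a i).
  apply: (@le_trans _ _ (b i * a i * (1 + q * a i))).
    by rewrite -qs; have : 0 < b i * a i by [rewrite mulr_gt0]; lra.
  by rewrite ler_pM2l ?mulr_gt0// expR_ge1Dx.
suff : - s <= \sum_(j <- Q | j != i) b j * a j * expR (q * a j) by lra.
apply: (@le_trans _ _ (\sum_(j <- Q | j != i) - `|b j * a j|)).
  rewrite sumrN lerN2 /s [leRHS](bigID (fun j => j != i))/= lerDl; exact: sumr_ge0.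
apply: ler_sum => j _; have [aj|aj] := leP 0 (a j).
  by apply: (@le_trans _ _ 0); rewrite ?oppr_le0// !mulr_ge0 ?expR_ge0// ltW.
have baj : b j * a j < 0 by rewrite pmulr_rlt0.
rewrite ltr0_norm// opprK ler_nMr// -[leRHS]expR0 ler_expR.
by rewrite mulr_ge0_le0// ltW.
Qed.

(* With [q0] the minimizer of [q |-> \sum b i * expR (q * a i)], tilting the
   weights by a parameter slightly larger than [q0] makes the mean of [a]
   positive but small, so that a fixed proportion of the tilted mass sits on
   words whose sum of [a] is large while the tilting factor stays moderate. *)
Lemma growth Q b a i j (K : R) : uniq Q -> (forall k, 0 < b k) ->
  i \in Q -> 0 < a i -> j \in Q -> a j < 0 ->
  (forall q, 1 < \sum_(k <- Q) b k * expR (q * a k)) ->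
  exists n, K <= \sum_(w <- words Q n | K <= asum a w) wt b w.
Proof.
move=> uQ b0 iQ ai jQ aj F1.
(* The derivative in [q] of [F Q b a]; its zero is found by the intermediate value theorem. *)
pose G := F Q (fun k => b k * a k) a.
have [qp Gp] : exists q, 0 <= G q by exact: drift_ge0 uQ b0 iQ ai.
have [qm Gm] : exists q, G q <= 0.
  have [q] := @drift_ge0 Q b (fun k => - a k) j uQ b0 jQ (ltac:(by rewrite oppr_gt0)).
  rewrite -oppr_le0 /F -sumrN => h; exists (- q).
  rewrite /G /F (eq_bigr (fun k => - (b k * - a k * expR (q * - a k)))) => // k _.
  by rewrite !mulrN !mulNr opprK.
have cG := @continuous_F Q (fun k => b k * a k) a.
have [q0 Gq0] : exists q, G q = 0.
  have cW u v : {within `[u, v], continuous G}.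
    by apply: continuous_subspaceT => x; exact: cG.
  have [le|/ltW le] := leP qm qp.
    have [|q _ Gq] := @IVT R G qm qp 0 le (cW _ _); last by exists q.
    by rewrite ge_min le_max Gm Gp orbT.
  have [|q _ Gq] := @IVT R G qp qm 0 le (cW _ _); last by exists q.
  by rewrite ge_min le_max Gm Gp orbT.
pose Fq := F Q b a; have cF := @continuous_F Q b a.
pose x := ln (Fq q0) / (2 * (`|q0| + 1)).
have q01 : 0 < `|q0| + 1 by rewrite ltr_wpDl.
have lnF : 0 < ln (Fq q0) by rewrite ln_gt0//; exact: F1.
have x0 : 0 < x by rewrite divr_gt0// mulr_gt0.
have Fx : 1 < Fq q0 * expR (- (`|q0| + 1) * x).
  rewrite -[Fq q0]lnK ?posrE ?(lt_trans ltr01 (F1 _))// -expRD expR_gt1.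
  have : (`|q0| + 1) * x = ln (Fq q0) / 2.
    by rewrite /x; move: lnF => _; field; rewrite gt_eqF.
  by rewrite mulNr => ->; lra.
have [h [h0 h1 hF hG]] : exists h, [/\ 0 < h, h <= 1,
    1 < Fq (q0 + h) * expR (- (`|q0| + 1) * x) & G (q0 + h) < x * Fq (q0 + h)].
  have e1 : \forall q \near q0, 1 < Fq q * expR (- (`|q0| + 1) * x).
    have : (fun q => Fq q * expR (- (`|q0| + 1) * x)) @ q0 -->
        Fq q0 * expR (- (`|q0| + 1) * x) by apply: cvgMl; exact: cF.
    by move/cvgr_gt; apply.
  have e2 : \forall q \near q0, G q - x * Fq q < 0.
    have : (fun q => G q - x * Fq q) @ q0 --> G q0 - x * Fq q0.
      by apply: cvgB; [exact: cG|apply: cvgMr; exact: cF].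
    move/cvgr_lt; apply; rewrite Gq0 sub0r oppr_lt0 mulr_gt0//.
    exact: (lt_trans ltr01 (F1 _)).
  have : \forall q \near q0, 1 < Fq q * expR (- (`|q0| + 1) * x) /\ G q - x * Fq q < 0.
    by apply: filterI; [exact: e1|exact: e2].
  move=> /nbhs_ballP[e /= e0 He].
  pose h := Num.min (e / 2) 1; have h0 : 0 < h by rewrite lt_min ltr01 divr_gt0.
  have he : h <= e / 2 by rewrite ge_min lexx.
  have [] : (1 < Fq (q0 + h) * expR (- (`|q0| + 1) * x)) /\ (G (q0 + h) - x * Fq (q0 + h) < 0).
    apply: He; rewrite /ball/= opprD addrA subrr sub0r normrN gtr0_norm//; lra.
  by exists h; split => //; [rewrite ge_min lexx orbT|rewrite -subr_lt0].
pose q := q0 + h; rewrite -/q in hF hG.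
(* [G] increases strictly, term by term: this is the convexity of [F Q b a]. *)
have Gq : 0 < G q.
  rewrite -Gq0 /G /F -subr_gt0 -sumrB (bigD1_seq i)//=.
  have tE k : b k * a k * expR (q * a k) - b k * a k * expR (q0 * a k) =
      b k * expR (q0 * a k) * (a k * (expR (h * a k) - 1)).
    by rewrite /q mulrDl expRD; ring.
  apply: ltr_wpDr.
    apply: sumr_ge0 => k _; rewrite tE mulr_ge0//; first by rewrite mulr_ge0 ?expR_ge0// ltW.
    have [ak|ak] := leP 0 (a k).
      rewrite mulr_ge0// subr_ge0; apply: le_trans (expR_ge1Dx _).
      by rewrite lerDl mulr_ge0// ltW.
    rewrite mulr_le0 ?(ltW ak)// subr_le0 expR_le1 mulr_ge0_le0// ltW//.
  rewrite tE mulr_gt0//; first by rewrite mulr_gt0// expR_gt0.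
  by rewrite mulr_gt0// subr_gt0 expR_gt1 mulr_gt0.
have Fq0 : 0 < Fq q by exact: (lt_trans ltr01 (F1 _)).
pose p k := b k * expR (q * a k) / Fq q.
have p0 k : 0 <= p k by rewrite divr_ge0 ?(ltW Fq0)// mulr_ge0 ?expR_ge0// ltW.
have p1 : \sum_(k <- Q) p k = 1 by rewrite -mulr_suml divff// gt_eqF.
have pa : \sum_(k <- Q) p k * a k = G q / Fq q.
  by rewrite /G /F mulr_suml; apply: eq_bigr => k _; rewrite /p; ring.
(* The tilted mean lies strictly between [y] and [x], so both tails of the window from [n * y] to
   [n * x] are exponentially small; at 1/4 each, half of the mass remains. *)
pose y := G q / Fq q / 2; have y0 : 0 < y by rewrite !divr_gt0.
have [r1 /andP[r10 r11] tail1] : exists2 r : R, 0 <= r < 1 &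
    forall n, \sum_(w <- words Q n | 0 <= asum (fun k => a k - x) w) wt p w <= r ^+ n.
  apply: words_tail => //; under eq_bigr do rewrite mulrBr.
  by rewrite sumrB -mulr_suml p1 mul1r pa subr_lt0 ltr_pdivrMr.
have [r2 /andP[r20 r21] tail2] : exists2 r : R, 0 <= r < 1 &
    forall n, \sum_(w <- words Q n | 0 <= asum (fun k => y - a k) w) wt p w <= r ^+ n.
  apply: words_tail => //; under eq_bigr do rewrite mulrBr.
  by rewrite sumrB -mulr_suml p1 mul1r pa subr_lt0 /y; move: y0; rewrite /y; lra.
pose g := Fq q * expR (- (`|q0| + 1) * x).
have small (r e : R) : 0 <= r < 1 -> 0 < e -> \forall n \near \oo, r ^+ n <= e.
  move=> /andP[r0 rlt1] e0; have rr : `|r| < 1 by rewrite ger0_norm.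
  have /cvgrPdist_le/(_ e e0) := cvg_expr rr.
  by apply: filterS => n; rewrite sub0r normrN ger0_norm// exprn_ge0.
have [n [n1 n2 n3 n4]] : exists n : nat,
    [/\ r1 ^+ n <= 1 / 4, r2 ^+ n <= 1 / 4, g^-1 ^+ n <= 1 / (2 * (`|K| + 1)) & `|K| <= n%:R * y].
  have K1 : 0 < `|K| + 1 by rewrite ltr_wpDl.
  have g1 : 0 <= g^-1 < 1.
    by rewrite invr_ge0 (ltW (lt_trans ltr01 hF)) invf_lt1// (lt_trans ltr01 hF).
  have h1' := small r1 (1 / 4) (ltac:(by rewrite r10)) (ltac:(lra)).
  have h2' := small r2 (1 / 4) (ltac:(by rewrite r20)) (ltac:(lra)).
  have h3' := small g^-1 (1 / (2 * (`|K| + 1))) g1 (ltac:(by rewrite divr_gt0// mulr_gt0)).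
  have h4' : \forall n \near \oo, `|K| / y <= n%:R by exact: nbhs_infty_ger.
  have [n _ Hn] := filterI (filterI h1' h2') (filterI h3' h4').
  exists n; have [[? ?] [? ?]] := Hn n (leqnn n); split => //.
  by rewrite -ler_pdivrMr.
exists n; have wsize w : w \in words Q n -> size w = n by rewrite mem_words => /andP[/eqP].
have asumB w (t : R) : asum (fun k => a k - t) w = asum a w - (size w)%:R * t.
  by rewrite /asum sumrB big_const_seq count_predT iter_addr_0 mulr_natl.
have asumB' w (t : R) : asum (fun k => t - a k) w = (size w)%:R * t - asum a w.
  by rewrite /asum sumrB big_const_seq count_predT iter_addr_0 mulr_natl.
have mid : 1 / 2 <= \sum_(w <- words Q n | n%:R * y <= asum a w <= n%:R * x) wt p w.
  have tot := sum_words Q p n; rewrite p1 expr1n in tot.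
  have : \sum_(w <- words Q n) wt p w <=
      \sum_(w <- words Q n | n%:R * y <= asum a w <= n%:R * x) wt p w +
      (\sum_(w <- words Q n | 0 <= asum (fun k => a k - x) w) wt p w +
       \sum_(w <- words Q n | 0 <= asum (fun k => y - a k) w) wt p w).
    rewrite [X in _ <= X + _]big_mkcond [X in _ <= _ + (X + _)]big_mkcond.
    rewrite [X in _ <= _ + (_ + X)]big_mkcond -!big_split/= big_seq [leRHS]big_seq.
    apply: ler_sum => w wQ; rewrite asumB asumB' (wsize w wQ) !subr_ge0.
    have w0 : 0 <= wt p w by exact: wt_ge0.
    have if0 (e : bool) : 0 <= (if e then wt p w else 0) by case: e.
    have [yw|/ltW wy] := leP (n%:R * y) (asum a w); last first.
      by rewrite wy /= add0r lerDr if0.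
    have [wx|/ltW xw] := leP (asum a w) (n%:R * x); last first.
      by rewrite xw /= add0r lerDl if0.
    by rewrite lerDl addr_ge0 ?if0.
  by rewrite tot; have := tail1 n; have := tail2 n; lra.
have wtp w : w \in words Q n -> wt b w = wt p w * Fq q ^+ n * expR (- (q * asum a w)).
  move=> /wsize wn; have -> : wt p w = wt b w * expR (q * asum a w) / Fq q ^+ n.
    rewrite -wt_tilt -wn /wt /p; elim: (w) => [|k u IH] /=.
      by rewrite !big_nil expr0 divr1.
    by rewrite !big_cons IH exprS invfM; ring.
  rewrite divfK ?expf_neq0 ?gt_eqF// -mulrA -expRD subrr expR0 mulr1//.
apply: (@le_trans _ _ (1 / 2 * g ^+ n)).
  have gn : 0 < g ^+ n by rewrite exprn_gt0// (lt_trans ltr01 hF).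
  move: n3; rewrite exprVn ler_pdivlMr ?mulr_gt0 ?ltr_wpDl//.
  rewrite -(ler_pM2l gn) mulrA divff ?gt_eqF// mul1r mulr1.
  by have := ler_norm K; lra.
apply: (@le_trans _ _ (\sum_(w <- words Q n | n%:R * y <= asum a w <= n%:R * x)
    wt p w * g ^+ n)).
  by rewrite -mulr_suml ler_wpM2r// exprn_ge0// (ltW (lt_trans ltr01 hF)).
rewrite big_mkcond [leRHS]big_mkcond/= big_seq [leRHS]big_seq.
apply: ler_sum => w wQ; have w0 : 0 <= wt p w by exact: wt_ge0.
have wb0 : 0 <= wt b w by apply: wt_ge0 => k; exact: ltW.
case: ifPn => [/andP[yw wx]|_]; last by case: ifP.
rewrite ifT; last by rewrite (le_trans (ler_norm K))// (le_trans n4).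
rewrite wtp// -mulrA ler_wpM2l// /g exprMn ler_wpM2l ?exprn_ge0 ?(ltW Fq0)//.
rewrite -expRM_natl ler_expR.
have aw : 0 <= asum a w by apply: le_trans yw; rewrite mulr_ge0// ltW.
have qq : q <= `|q0| + 1 by rewrite /q; have := ler_norm q0; lra.
have : q * asum a w <= (`|q0| + 1) * (n%:R * x).
  apply: (@le_trans _ _ ((`|q0| + 1) * asum a w)); first by rewrite ler_wpM2r.
  by rewrite ler_pM2l.
lra.
Qed.

End exponential_growth.

(** * Lower bounds for the dimension *)

Section lower_bound.
Variables (R : realType) (d m : nat) (eps : 'I_m -> bool).
Variables (S : 'I_m -> 'rV[R]_d -> 'rV[R]_d) (lam c : 'I_m -> R).
Variable f : R -> 'rV[R]_d.
Hypothesis Hsys : self_affine_system eps lam c S.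
Hypothesis Hf : self_affine_function eps c S f.

Let m_ge2 := sas_size Hsys.
Let c_gt0 := sas_weight Hsys.
Let c_sum := sas_weight_sum Hsys.

Local Notation Phi := (word_map eps c).
Local Notation disc := (discrepancy lam c).

Lemma disc_bound al w :
  `|disc al w| <= (size w)%:R * \sum_(i < m) `|ln (lam i) - al * ln (c i)|.
Proof.
rewrite /discrepancy; elim: w => [|i w IH]; first by rewrite big_nil normr0 mul0r.
rewrite big_cons; apply: (le_trans (ler_normD _ _)).
rewrite /= -natr1 mulrDl mul1r addrC; apply: lerD => //.
by rewrite (bigD1 i)//= lerDl; exact: sumr_ge0.
Qed.

(* Each block of the Cantor set is a word [w] over [Q] followed by a fixed
   interior word [u], which keeps the blocks away from each other and from the
   endpoints. *)
Lemma dim_ge_of_blocks (al s : R) (Q : seq 'I_m) i j : 0 < al -> 0 < s -> uniq Q ->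
  (forall k, k \in Q -> 0 < lam k) -> i \in Q -> j \in Q -> i != j ->
  (forall (b : bool) u, all (mem Q) u -> exists n,
     1 <= \sum_(w <- words Q n | if b then 0 <= disc al (w ++ u) else disc al (w ++ u) <= 0)
       wt c (w ++ u) `^ s) ->
  (s%:E <= hausdorff_dim (level_set f al%:E))%E.
Proof.
move=> al0 s0 uQ Qpos iQ jQ ij H.
have [u [k [au k0 uk]]] := interior_word eps c_gt0 c_sum ij.
have uQ' : all (mem Q) u.
  by apply: sub_all au => l /= /orP[/eqP ->|/eqP ->].
have [n Hn] := choice (fun b => H b u uQ').
pose sg (b : bool) v := if b then 0 <= disc al v else disc al v <= 0.
pose B b := [seq w ++ u | w <- words Q (n b) & sg b (w ++ u)].
have BP b v : v \in B b -> exists w, [/\ w \in words Q (n b), v = w ++ u & sg b v].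
  by move=> /mapP[w]; rewrite mem_filter => /andP[sw wQ] ->; exists w.
have k1 : k <= 1 / 2 by have := uk 0; rewrite lexx ler01 => /(_ isT); lra.
pose tot b := \sum_(v <- B b) wt c v `^ s.
have tot1 b : 1 <= tot b.
  by rewrite /tot /B big_map big_filter; exact: Hn.
have tot0 b : 0 < tot b by exact: lt_le_trans (tot1 b).
have [a [bb [a0 ab b1 cab]]] := weight_bounds m_ge2 c_gt0 c_sum.
have a1 : a <= 1 by exact: (le_trans ab (ltW b1)).
(* A bound for the lengths of all blocks of both kinds, giving uniform margins and a uniform bound
   on the discrepancy. *)
pose N0 := (n true + n false + size u)%N.
have nN b : (n b <= n true + n false)%N by case: b; rewrite ?leq_addr ?leq_addl.
have ac l : a <= c l by case/andP: (cab l).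
have aN0 w : (size w <= N0)%N -> a ^+ N0 <= wt c w.
  by move=> wN; apply: le_trans (cw_ge w (ltW a0) ac); rewrite ler_wiXn2l// ltW.
have szw b w : w \in words Q (n b) -> size w = n b by rewrite mem_words => /andP[/eqP].
have kapw b w : w \in words Q (n b) -> a ^+ N0 * k <= wt c w * k.
  move=> wQ; rewrite ler_pM2r// aN0// (szw _ _ wQ) /N0.
  exact: leq_trans (nN b) (leq_addr _ _).
pose MM := N0%:R * \sum_(i < m) `|ln (lam i) - al * ln (c i)|.
have MM0 : 0 <= MM by rewrite mulr_ge0// sumr_ge0.
have discM b v : v \in B b -> - MM <= disc al v <= MM.
  move=> /BP[w [wQ -> _]]; rewrite -ler_norml; apply: (le_trans (disc_bound _ _)).
  rewrite ler_wpM2r ?sumr_ge0// ler_nat size_cat (szw _ _ wQ) leq_add2r.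
  exact: nN.
apply: (cantor_dim Hsys Hf al0 s0 (kap := a ^+ N0 * k) (M := MM) (B := B)
  (p := fun b v => wt c v `^ s / tot b)).
- by rewrite mulr_gt0// exprn_gt0.
- move=> b; rewrite map_inj_uniq ?filter_uniq ?words_uniq// => v w.
  move=> vw; have /addIn sz : (size v + size u = size w + size u)%N.
    by rewrite -!size_cat vw.
  by move/eqP: vw; rewrite eqseq_cat// => /andP[/eqP].
- move=> b v /BP[w [wQ -> _]]; rewrite all_cat; move: wQ.
  rewrite mem_words => /andP[_ aw]; apply/andP; split; apply/allP => l lw; apply: Qpos.
    exact: (allP aw).
  exact: (allP uQ').
- by move=> b v _; rewrite divr_gt0// powR_gt0// cw_gt0.
- by move=> b; rewrite -mulr_suml -/(tot b) divff// gt_eqF.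
- by move=> b v _; rewrite ler_pdivrMr// ler_peMr// powR_ge0.
- move=> b v vB; have /andP[h1 h2] := discM b v vB; have [w [_ _]] := BP b v vB.
  by case: b {vB} => /= ->; rewrite ?h1 ?h2.
- move=> b v x /BP[w [wQ -> _]] x01; rewrite Phi_cat.
  have /andP[p0 p1] := Phi01 eps c_gt0 c_sum w (Phi01 eps c_gt0 c_sum u x01).
  have out z : ~ (0 < z < 1) -> a ^+ N0 * k <= `|Phi w (Phi u x) - z|.
    move=> nz; have [z' zz'] := Phi_surj eps c_gt0 w z.
    rewrite zz'; apply: (le_trans (kapw b w wQ)).
    apply: Phi_outside => //; first exact: uk.
    by move=> /(Phi_oo eps c_gt0 c_sum w); rewrite -zz'.
  have n0 : ~ (0 < (0 : R) < 1) by rewrite ltxx.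
  have n1 : ~ (0 < (1 : R) < 1) by rewrite ltxx andbF.
  have o0 := out _ n0; rewrite subr0 ger0_norm// in o0.
  have o1 := out _ n1; rewrite distrC ger0_norm ?subr_ge0// in o1.
  by lra.
- move=> b v v' x y /BP[w [wQ -> _]] /BP[w' [w'Q -> _]] vv' x01 y01; rewrite !Phi_cat.
  have [z wz] := Phi_surj eps c_gt0 w (Phi w' (Phi u y)).
  rewrite wz; apply: (le_trans (kapw b w wQ)); apply: Phi_outside => //.
    exact: uk.
  apply: (Phi_disjoint c_gt0 c_sum _ _ _ (esym wz)).
  - by rewrite (szw _ _ wQ) (szw _ _ w'Q).
  - by apply: contra_neq vv' => ->.
  - exact: Phi01.
- move=> b v /BP[w [wQ -> _]]; apply: (@le_trans _ _ (a ^+ N0)).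
    by rewrite ler_piMr ?exprn_ge0 ?(ltW a0)//; lra.
  by apply: aN0; rewrite size_cat (szw _ _ wQ) leq_add2r.
Qed.

Lemma wt_powR (s : R) w : wt (fun i => c i `^ s) w = wt c w `^ s.
Proof.
elim: w => [|i w IH]; first by rewrite !wt_nil powR1.
by rewrite !wt_cons IH powRM ?(ltW (c_gt0 i)) ?(ltW (cw_gt0 c_gt0 w)).
Qed.

Let posQ := [seq i <- index_enum 'I_m | 0 < lam i].

Let sum_posQ (F : 'I_m -> R) : \sum_(i <- posQ) F i = \sum_(i < m | 0 < lam i) F i.
Proof. by rewrite big_filter. Qed.

Let mem_posQ i : (i \in posQ) = (0 < lam i).
Proof. by rewrite mem_filter mem_index_enum andbT. Qed.

Lemma powR_expR (x a : R) : 0 < x -> x `^ a = expR (a * ln x).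
Proof. by move=> x0; rewrite /powR gt_eqF. Qed.

Lemma dim_ge_interior (al s : R) i j : 0 < al -> 0 < s ->
  0 < lam i -> 0 < lam j -> ln (lam i) < al * ln (c i) -> al * ln (c j) < ln (lam j) ->
  (forall q, 1 < \sum_(k < m | 0 < lam k) lam k `^ q * c k `^ (s - al * q)) ->
  (s%:E <= hausdorff_dim (level_set f al%:E))%E.
Proof.
move=> al0 s0 li lj lti ltj F1.
have uQ : uniq posQ by rewrite filter_uniq// index_enum_uniq.
pose a k := ln (lam k) - al * ln (c k).
have b0 k : 0 < c k `^ s by rewrite powR_gt0.
have G1 q : 1 < \sum_(k <- posQ) c k `^ s * expR (q * a k).
  rewrite sum_posQ; apply: (lt_le_trans (F1 q)); apply: ler_sum => k lk.
  rewrite !powR_expR// -!expRD ler_expR /a le_eqVlt; apply/orP; left; apply/eqP; ring.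
have ai : a i < 0 by rewrite subr_lt0.
have aj : 0 < a j by rewrite subr_gt0.
have iQ : i \in posQ by rewrite mem_posQ.
have jQ : j \in posQ by rewrite mem_posQ.
have ij : i != j by apply/eqP => ij; move: ai; rewrite ij; lra.
apply: (dim_ge_of_blocks al0 s0 uQ _ iQ jQ ij) => [k|b u _]; first by rewrite mem_posQ.
have cu0 : 0 < wt c u `^ s by rewrite powR_gt0// cw_gt0.
(* Large enough to absorb the discrepancy and the mass of the fixed final word [u]. *)
pose K := Num.max `|disc al u| (wt c u `^ s)^-1.
have Ku : `|disc al u| <= K by rewrite le_max lexx.
have Kc : (wt c u `^ s)^-1 <= K by rewrite le_max lexx orbT.
have Kb : 1 <= K * wt c u `^ s by rewrite -ler_pdivrMr// mul1r.
have conv n (P P' : pred (seq 'I_m)) : (forall w, P w -> P' w) ->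
    K <= \sum_(w <- words posQ n | P w) wt (fun i => c i `^ s) w ->
    1 <= \sum_(w <- words posQ n | P' w) wt c (w ++ u) `^ s.
  move=> PP' h; apply: (le_trans Kb).
  apply: (le_trans (ler_wpM2r (ltW cu0) h)); rewrite mulr_suml.
  rewrite big_mkcond [leRHS]big_mkcond/=; apply: ler_sum => w _.
  case: ifPn => [/PP' ->|_]; last by case: ifP => // _; exact: powR_ge0.
  by rewrite wt_cat wt_powR powRM ?(ltW (cw_gt0 c_gt0 _)).
case: b.
  have [n] := growth K uQ b0 jQ aj iQ ai G1; exists n.
  apply: conv p => w; rewrite /asum -/(disc al w) disc_cat => h.
  by move: Ku; rewrite ler_norml; lra.
have nai : 0 < - a i by rewrite oppr_gt0.
have naj : - a j < 0 by rewrite oppr_lt0.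
have [|n] := growth K (a := fun k => - a k) uQ b0 iQ nai jQ naj.
  by move=> q; under eq_bigr do rewrite mulrN -mulNr; exact: G1.
exists n; apply: conv p => w; rewrite /asum sumrN -/(disc al w) disc_cat => h.
by move: Ku; rewrite ler_norml; lra.
Qed.

(** All words over these letters have discrepancy 0, hence fit both kinds of blocks; their total
    mass grows geometrically because [s < s0]. *)
Lemma dim_ge_extreme (al s s0 : R) : 0 < al -> 0 < s -> s < s0 ->
  \sum_(i < m | (0 < lam i) && (ln (lam i) == al * ln (c i))) c i `^ s0 = 1 ->
  (s%:E <= hausdorff_dim (level_set f al%:E))%E.
Proof.
move=> al0 s_gt0 ss0 Hs0; pose P i := (0 < lam i) && (ln (lam i) == al * ln (c i)).
pose Q := [seq i <- index_enum 'I_m | P i].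
have uQ : uniq Q by rewrite filter_uniq// index_enum_uniq.
have memQ i : (i \in Q) = P i by rewrite mem_filter mem_index_enum andbT.
have c01 i : 0 < c i < 1 by rewrite c_gt0 (c_lt1 Hsys).
have cs1 i : c i `^ s0 < 1.
  by rewrite -[ltRHS](powRr0 (c i)); apply: ltr_powR => //; exact: lt_trans ss0.
have [i Pi] : exists i, P i.
  apply: contrapT => H; move: Hs0; rewrite big1 => [/eqP|i Pi]; first by rewrite eq_sym oner_eq0.
  by exfalso; apply: H; exists i.
have [j Pj ji] : exists2 j, P j & j != i.
  apply: contrapT => H; move: Hs0; rewrite (bigD1 i)//= big1 => [|j /andP[Pj ji]].
    by have := cs1 i; lra.
  by exfalso; apply: H; exists j.
have sum1 : 1 < \sum_(i <- Q) c i `^ s.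
  rewrite -Hs0 big_filter (bigD1 i)//= [ltRHS](bigD1 i)//=.
  apply: ltr_leD; first by apply: ltr_powR.
  by apply: ler_sum => k _; apply: ltW; apply: ltr_powR.
apply: (dim_ge_of_blocks (Q := Q) (i := j) (j := i)) => //; rewrite ?memQ//.
  by move=> k; rewrite memQ => /andP[].
have disc0 w : all (mem Q) w -> disc al w = 0.
  move=> aw; rewrite /discrepancy big_seq big1// => k kw.
  have := allP aw k kw; rewrite inE memQ => /andP[_ /eqP ->].
  by rewrite subrr.
move=> b u uQ'; have cu0 : 0 < wt c u `^ s by rewrite powR_gt0// cw_gt0.
have [n hn] : exists n, (wt c u `^ s)^-1 <= (\sum_(i <- Q) c i `^ s) ^+ n.
  set g := \sum_(i <- Q) _ in sum1 *; have g0 : 0 < g by exact: lt_trans sum1.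
  have gi : `|g^-1| < 1 by rewrite ger0_norm ?invr_ge0 ?(ltW g0)// invf_lt1.
  have /cvgrPdist_le/(_ _ cu0)[n _ /(_ n (leqnn n))] := cvg_expr gi.
  rewrite /= sub0r normrN ger0_norm ?exprn_ge0 ?invr_ge0 ?(ltW g0)// exprVn => h.
  by exists n; rewrite -[leRHS]invrK lef_pV2 ?posrE ?invr_gt0 ?exprn_gt0.
rewrite -sum_words -(ler_pM2r cu0) mulVf ?(gt_eqF cu0)// in hn.
exists n; apply: (le_trans hn); rewrite mulr_suml big_seq [leRHS]big_mkcond [leRHS]big_seq/=.
apply: ler_sum => w; rewrite mem_words => /andP[_ aw].
rewrite disc_cat !disc0// addr0 lexx if_same wt_cat wt_powR powRM//.
  exact: ltW (cw_gt0 c_gt0 _).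
exact: ltW (cw_gt0 c_gt0 _).
Qed.

End lower_bound.

(** * The spectrum *)

Section spectrum.
Variables (R : realType) (d m : nat) (eps : 'I_m -> bool).
Variables (S : 'I_m -> 'rV[R]_d -> 'rV[R]_d) (lam c : 'I_m -> R).
Variable f : R -> 'rV[R]_d.
Hypothesis Hsys : self_affine_system eps lam c S.
Hypothesis Hf : self_affine_function eps c S f.

Let m_ge2 := sas_size Hsys.
Let c_gt0 := sas_weight Hsys.
Let c_sum := sas_weight_sum Hsys.

Local Notation Phi := (word_map eps c).
Local Notation rho := (rho lam c).
Local Notation amin := (alpha_min lam c).
Local Notation amax := (alpha_max lam c).
Local Notation leb := ((wlength (@idfun R))^*%mu).

Let cl01 (z : R) : 0 < z < 1 -> 0 <= z <= 1.
Proof. by move=> /andP[/ltW -> /ltW ->]. Qed.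

Let c01 i : 0 < c i < 1.
Proof. by rewrite c_gt0 (c_lt1 Hsys). Qed.

Lemma ln_c_lt0 i : ln (c i) < 0.
Proof. exact: ln_lt0. Qed.

Lemma ln_lamE i : ln (lam i) = rho i * ln (c i).
Proof. by rewrite /Defs.rho divfK// lt_eqF// ln_c_lt0. Qed.

Lemma rho_gt0 i : 0 < lam i -> 0 < rho i.
Proof.
move=> li; rewrite /Defs.rho nmulr_rgt0 ?invr_lt0 ?ln_c_lt0// ln_lt0//.
by rewrite li (lam_lt1 Hsys).
Qed.

Lemma alpha_min_le i : 0 < lam i -> amin <= rho i.
Proof.
move=> li; apply: ge_inf; last by exists i.
by exists 0 => _ [j lj <-]; rewrite ltW// rho_gt0.
Qed.

Lemma alpha_max_ge i : 0 < lam i -> rho i <= amax.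
Proof.
move=> li; apply: ub_le_sup; last by exists i.
exists (\sum_(k < m | 0 < lam k) rho k) => _ [j lj <-].
rewrite (bigD1 j)//= lerDl; apply: sumr_ge0 => k /andP[lk _].
by rewrite ltW// rho_gt0.
Qed.

Lemma in_holder_everywhere (al t : R) : 0 < al ->
  (forall i, 0 < lam i -> al <= rho i) -> 0 < t < 1 -> in_holder f t al.
Proof.
move=> al0 Hal t01; have [a [D [a0 D0 HD]]] := oscillation_upper Hsys Hf.
have lw w : wt lam w <= wt c w `^ al.
  elim: w => [|i w IH]; first by rewrite !wt_nil powR1.
  rewrite !wt_cons powRM ?(ltW (c_gt0 i)) ?(ltW (cw_gt0 c_gt0 w))//.
  apply: ler_pM => //; rewrite ?(lam_ge0 Hsys)//.
    by apply: wt_ge0 => j; exact: (lam_ge0 Hsys).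
  have [l0|l0] := leP (lam i) 0; first exact: le_trans (powR_ge0 _ _).
  rewrite powR_expR// -[leLHS]lnK ?posrE// ler_expR ln_lamE.
  by rewrite ler_nM2r ?ln_c_lt0// Hal.
exists (2 * D * a^-1 `^ al) => z z01; have [->|zt] := eqVneq z t.
  by rewrite !subrr enorm0 !mulr_ge0 ?powR_ge0// ltW.
have [v [w [_ _ _ [/andP[_ hv] /andP[_ hw]] h]]] := HD _ _ (cl01 z01) (cl01 t01) zt.
apply: (le_trans h); set r := `|z - t| in hv hw *; have r0 : 0 <= r by exact: normr_ge0.
have bound u : wt c u <= r / a -> wt lam u <= r `^ al * a^-1 `^ al.
  move=> h'; apply: (le_trans (lw u)); rewrite -powRM ?invr_ge0 ?(ltW a0)//.
  apply: ge0_ler_powR; rewrite ?nnegrE ?(ltW al0) ?(ltW (cw_gt0 c_gt0 u))//.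
  by rewrite divr_ge0// ltW.
have -> : 2 * D * a^-1 `^ al * r `^ al =
    D * (r `^ al * a^-1 `^ al + r `^ al * a^-1 `^ al) by ring.
by rewrite ler_pM2l// lerD ?bound.
Qed.

Lemma not_in_holder (al al' t : R) : 0 <= al ->
  (forall i, 0 < lam i -> rho i <= al) -> al < al' ->
  (forall n, exists w, [/\ size w = n, 0 < wt lam w &
     exists2 x : R, 0 <= x <= 1 & t = Phi w x]) ->
  ~ in_holder f t al'.
Proof.
move=> al0 Hal aa' Hw /(in_holder_word Hsys Hf (le_trans al0 (ltW aa')))[K K0 HK].
have lw w : 0 < wt lam w -> wt c w `^ al <= wt lam w.
  elim: w => [|i w IH]; first by rewrite !wt_nil powR1.
  rewrite !wt_cons => lw0.
  have li : 0 < lam i.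
    rewrite lt_def (lam_ge0 Hsys) andbT; apply/eqP => l0.
    by move: lw0; rewrite l0 mul0r ltxx.
  rewrite pmulr_rgt0// in lw0.
  rewrite powRM ?(ltW (c_gt0 i)) ?(ltW (cw_gt0 c_gt0 w))//.
  apply: ler_pM; rewrite ?powR_ge0 ?IH//.
  rewrite powR_expR// -[leRHS]lnK ?posrE// ler_expR ln_lamE.
  by rewrite ler_nM2r ?ln_c_lt0// Hal.
have [a [b [a0 ab b1 cab]]] := weight_bounds m_ge2 c_gt0 c_sum.
have b0 : 0 <= b by apply: le_trans ab; exact: ltW.
have d0 : 0 < al' - al by rewrite subr_gt0.
pose e := K^-1 `^ (al' - al)^-1; have e0 : 0 < e by rewrite powR_gt0// invr_gt0.
have rb : `|b| < 1 by rewrite ger0_norm.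
have /cvgrPdist_lt/(_ e e0)[n _ /(_ n (leqnn n))] := cvg_expr rb.
rewrite /= sub0r normrN ger0_norm ?exprn_ge0// => bn.
have [w [wn lw0 [x x01 tx]]] := Hw n; have cw := cw_gt0 c_gt0 w.
have cwe : wt c w < e.
  apply: le_lt_trans bn; rewrite -wn; apply: (cw_le c_gt0) => i; by case/andP: (cab i).
have : wt c w `^ al <= K * wt c w `^ al' by exact: le_trans (lw w lw0) (HK w x x01 tx).
have -> : al' = al + (al' - al) by ring.
rewrite powRD ?(gt_eqF cw) ?implybT// mulrCA ler_pMr ?powR_gt0// leNgt => /negP[].
have : wt c w `^ (al' - al) < e `^ (al' - al).
  by apply: gt0_ltr_powR; rewrite ?nnegrE ?(ltW e0) ?(ltW cw).
rewrite /e -powRrM mulVf ?gt_eqF// powRr1 ?invr_ge0 ?(ltW K0)// => h.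
by rewrite mulrC -ltr_pdivlMr// div1r.
Qed.

Let exists_pos : exists i, 0 < lam i.
Proof. by have [i [_ [_ li _]]] := two_positive_ratios Hsys Hf; exists i. Qed.

Hypothesis amin_gt0 : 0 < amin.

Let amax_gt0 : 0 < amax.
Proof.
have [i li] := exists_pos; apply: lt_le_trans amin_gt0 _.
exact: le_trans (alpha_min_le li) (alpha_max_ge li).
Qed.

Lemma exponent_ge_alpha_min (t : R) : 0 < t < 1 -> (amin%:E <= holder_exponent f t)%E.
Proof.
move=> t01; apply: holder_exponent_ge => //.
by apply: in_holder_everywhere => // i; exact: alpha_min_le.
Qed.

Lemma exponent_le_alpha_max (t : R) : 0 < t < 1 ->
  (forall n, exists w, [/\ size w = n, 0 < wt lam w &
     exists2 x : R, 0 <= x <= 1 & t = Phi w x]) ->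
  (holder_exponent f t <= amax%:E)%E.
Proof.
move=> t01 Hw; apply: holder_exponent_le; first exact: ltW amax_gt0.
by move=> a' aa'; apply: (not_in_holder (ltW amax_gt0) _ aa') => // i; exact: alpha_max_ge.
Qed.

Lemma exponent_finite_le (t : R) : 0 < t < 1 -> (holder_exponent f t < +oo)%E ->
  (holder_exponent f t <= amax%:E)%E.
Proof.
move=> t01 et; apply: exponent_le_alpha_max => // n.
exact: (positive_word Hsys Hf).
Qed.

Lemma exponent_finite (t : R) : (forall i, lam i <> 0) -> 0 < t < 1 ->
  (holder_exponent f t < +oo)%E.
Proof.
move=> l0 t01; apply: (@le_lt_trans _ _ amax%:E); last exact: ltry.
apply: exponent_le_alpha_max => // n.
have [w [wn Hw]] := Phi_cover eps m_ge2 c_gt0 c_sum n (cl01 t01).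
exists w; split => //; apply: wt_gt0 => i _; rewrite lt_def (lam_ge0 Hsys) andbT.
by apply/eqP; exact: l0.
Qed.

Lemma level_set_empty (al : \bar R) : (0 < al)%E ->
  ~ ((amin%:E <= al <= amax%:E)%E \/ al = +oo%E) -> level_set f al = set0.
Proof.
move=> al0 H; rewrite -subset0 => t [t01 et]; apply: H.
have [->|ny] := eqVneq al +oo%E; [by right|left].
by rewrite -et exponent_ge_alpha_min//= exponent_finite_le// et lt_neqAle ny leey.
Qed.

Lemma level_set_pinfty0 : (forall i, lam i <> 0) -> level_set f +oo%E = set0.
Proof.
move=> l0; rewrite -subset0 => t [t01 et].
by have := exponent_finite l0 t01; rewrite et ltxx.
Qed.

(** For [q = 0] and [s = 1] the covering sum is the total weight of the nonflat letters, less than 1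
    once a flat letter exists. *)
Lemma level_set_pinfty_full : (exists i, lam i = 0) ->
  has_lebesgue_measure_one (level_set f +oo%E).
Proof.
move=> [i0 l0]; apply: has_lebesgue_measure_one_null; first by move=> t [].
have H : hausdorff_measure 1
    [set t : R | 0 < t < 1 /\ (0%:E < holder_exponent f t < +oo)%E] = 0%E.
  apply: (hausdorff_exponent_gt Hsys Hf (q := 0)) => //.
  rewrite mulr0 subr0 -[ltRHS]c_sum [ltRHS](bigID (fun i => 0 < lam i))/= ltr_pwDr//.
    rewrite (bigD1 i0)/=; last by rewrite l0 ltxx.
    by rewrite ltr_pwDl// sumr_ge0// => i _; rewrite ltW.
  by apply: ler_sum => i _; rewrite powRr0 mul1r powRr1// ltW.
apply: leb_sub0 (hausdorff_measure1_leb H) => t [/= t01 nE]; split => //.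
rewrite (lt_le_trans _ (exponent_ge_alpha_min t01)) ?lte_fin//=.
by rewrite ltey; apply/eqP => et; exact: nE.
Qed.

Lemma dim_level_set_le (q s al : R) : 0 <= s -> 0 < al ->
  \sum_(i < m | 0 < lam i) lam i `^ q * c i `^ (s - al * q) <= 1 ->
  (hausdorff_dim (level_set f al%:E) <= s%:E)%E.
Proof.
move=> s0 al0 H; apply: hausdorff_dim_le => // s' ss'.
exact: (hausdorff_level_set0 Hsys Hf ss' (le_lt_trans s0 ss') al0 H).
Qed.

Let weightE q r i : 0 < lam i -> lam i `^ q * c i `^ r = c i `^ (rho i * q + r).
Proof.
move=> li; rewrite !powR_expR// -expRD ln_lamE; congr expR; ring.
Qed.

(** The sign [e] selects the end of the spectrum. Along [q = e * n] the covering weights of the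
    other letters tend to 0, and only the sum over the extreme letters remains. *)
Lemma dim_extreme (e al s0 : R) : 0 < al -> 0 <= s0 -> `|e| = 1 ->
  (forall i, 0 < lam i -> 0 <= e * (rho i - al)) ->
  \sum_(i < m | (0 < lam i) && (rho i == al)) c i `^ s0 = 1 ->
  hausdorff_dim (level_set f al%:E) = s0%:E.
Proof.
move=> al0 s00 e1 He Hs0; apply/eqP; rewrite eq_le; apply/andP; split; last first.
  apply/lee_subgt0Pr => x x0; rewrite -EFinB.
  have [sx|sx] := leP (s0 - x) 0.
    by apply: le_trans (hausdorff_dim_ge0 _); rewrite lee_fin.
  apply: (dim_ge_extreme Hsys Hf al0 sx (s0 := s0)); first by lra.
  rewrite -[RHS]Hs0; apply: eq_bigl => i; congr (_ && _).
  rewrite ln_lamE; apply/eqP/eqP => [/mulIf ->//|->//].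
  by rewrite lt_eqF// ln_c_lt0.
apply: hausdorff_dim_le => // s' s0s'.
pose s := (s0 + s') / 2; have s0s : s0 < s by rewrite /s; lra.
have ss' : s < s' by rewrite /s; lra.
have c1 : \sum_(i < m | (0 < lam i) && (rho i == al)) c i `^ s < 1.
  rewrite -Hs0; have [i Pi] : exists i, (0 < lam i) && (rho i == al).
    apply: contrapT => H; move: Hs0; rewrite big1 => [/eqP|i Pi].
      by rewrite eq_sym oner_eq0.
    by exfalso; apply: H; exists i.
  rewrite (bigD1 i)//= [ltRHS](bigD1 i)//=; apply: ltr_leD; first exact: ltr_powR.
  by apply: ler_sum => k _; apply: ltW; apply: ltr_powR.
set C := \sum_(i < m | _) _ in c1.
pose g i := c i `^ (e * (rho i - al)).
have m0 : 0 < (m%:R : R) by rewrite ltr0n; exact: ltnW.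
(* The room left below 1 by the extreme letters, shared equally among all letters. *)
pose del := (1 - C) / m%:R; have del0 : 0 < del by rewrite divr_gt0// subr_gt0.
have near_i i : \forall n \near \oo, 0 < lam i -> rho i != al -> g i ^+ n <= del.
  have [/andP[li ri]|/nandP nP] := boolP ((0 < lam i) && (rho i != al)); last first.
    by apply: nearW => n li ri; case: nP; rewrite ?li ?ri.
  have g1 : `|g i| < 1.
    rewrite ger0_norm ?powR_ge0// -[ltRHS](powRr0 (c i)); apply: ltr_powR => //.
    rewrite lt_def He// andbT mulf_neq0 ?subr_eq0//.
    by rewrite -normr_eq0 e1 oner_eq0.
  have /cvgrPdist_le/(_ _ del0) := cvg_expr g1.
  apply: filterS => n; rewrite sub0r normrN ger0_norm ?exprn_ge0 ?powR_ge0//.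
have : \forall n \near \oo, forall i, 0 < lam i -> rho i != al -> g i ^+ n <= del.
  exact: (@filter_forall _ _ (fun i n => 0 < lam i -> rho i != al -> g i ^+ n <= del)).
move=> [n _ /(_ n (leqnn n)) Hn].
apply: (hausdorff_level_set0 Hsys Hf (q := e * n%:R) ss' _ al0); first lra.
rewrite (bigID (fun i => rho i == al))/=.
rewrite [leRHS](_ : _ = C + \sum_(i < m) del); last first.
  by rewrite sumr_const card_ord -[del *+ m]mulr_natr divfK ?gt_eqF//; ring.
apply: lerD.
  apply: ler_sum => i /andP[li /eqP ri]; rewrite weightE// ri.
  by rewrite le_eqVlt; apply/orP; left; apply/eqP; congr (_ `^ _); ring.
rewrite big_mkcond/=; apply: ler_sum => i _; case: ifPn => [/andP[li ri]|_]; last exact: ltW.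
apply: le_trans (Hn i li ri); rewrite weightE// /g -powR_mulrn ?powR_ge0// -powRrM.
have -> : rho i * (e * n%:R) + (s - al * (e * n%:R)) =
  e * (rho i - al) * n%:R + s by ring.
rewrite powRD ?(gt_eqF (c_gt0 i)) ?implybT// ler_piMr ?powR_ge0//.
rewrite -[leRHS](powRr0 (c i)); apply: ltW; apply: ltr_powR => //; lra.
Qed.

Variables (shat : R) (beta : R -> R).
Hypothesis shat_ge0 : 0 <= shat.
Hypothesis Hshat : \sum_(i < m | 0 < lam i) c i `^ shat = 1.
Hypothesis Hbeta : forall q : R,
  \sum_(i < m | 0 < lam i) lam i `^ q * c i `^ beta q = 1.

Local Notation ahat := (alpha_hat lam c shat).
Hypotheses (amin_attained : exists2 i, 0 < lam i & rho i = amin)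
  (amax_attained : exists2 i, 0 < lam i & rho i = amax).

Lemma dim_level_set_interior (al : R) : amin < al < amax ->
  hausdorff_dim (level_set f al%:E) = beta_star beta al.
Proof.
move=> /andP[a1 a2]; have al0 : 0 < al by exact: lt_trans a1.
have [i li ri] := amin_attained; have [j lj rj] := amax_attained.
(* Otherwise the term of an extreme letter in the equation for [beta q] would exceed 1. This makes
   the infimum finite and every upper bound nonnegative. *)
have nneg q : 0 <= al * q + beta q.
  rewrite leNgt; apply/negP => neg.
  have [k lk rk] : exists2 k, 0 < lam k & rho k * q <= al * q.
    have [q0|q0] := leP 0 q.
      by exists i => //; rewrite ler_wpM2r// ri ltW.
    by exists j => //; rewrite ler_wnM2r ?ltW// rj.
  have := Hbeta q; rewrite (bigD1 k)//= weightE//.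
  have : 0 <= \sum_(i0 < m | (0 < lam i0) && (i0 != k)) lam i0 `^ q * c i0 `^ beta q.
    by apply: sumr_ge0 => l _; rewrite mulr_ge0 ?powR_ge0.
  have : 1 < c k `^ (rho k * q + beta q).
    by rewrite -[ltLHS](powRr0 (c k)); apply: ltr_powR => //; lra.
  by lra.
apply/eqP; rewrite eq_le; apply/andP; split.
  apply: le_ereal_inf_tmp => _ [q _ <-].
  apply: (dim_level_set_le (q := q)) => //.
  have -> : al * q + beta q - al * q = beta q by ring.
  by rewrite Hbeta.
have bfin : beta_star beta al \is a fin_num.
  rewrite fin_numE; apply/andP; split; apply/eqP => bE.
    have : (0%:E <= beta_star beta al)%E.
      by apply: le_ereal_inf_tmp => _ [q _ <-]; rewrite lee_fin.
    by rewrite bE.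
  have : (beta_star beta al <= (al * 0 + beta 0)%:E)%E.
    by apply: ereal_inf_lbound; exists 0.
  by rewrite bE leye_eq.
apply/lee_subgt0Pr => x x0; rewrite -(fineK bfin) -EFinB.
set s := fine _ - x; have [s0|s0] := leP s 0.
  by apply: le_trans (hausdorff_dim_ge0 _); rewrite lee_fin.
have sq q : s < al * q + beta q.
  have : (beta_star beta al <= (al * q + beta q)%:E)%E.
    by apply: ereal_inf_lbound; exists q.
  by rewrite -(fineK bfin) lee_fin /s; lra.
have lc k := ln_c_lt0 k.
apply: (dim_ge_interior Hsys Hf (i := j) (j := i)) => //.
- by rewrite ln_lamE rj ltr_nM2r.
- by rewrite ln_lamE ri ltr_nM2r.
move=> q; rewrite -(Hbeta q) (bigD1 i)//= [ltRHS](bigD1 i)//=.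
have lt k : 0 < lam k ->
    lam k `^ q * c k `^ beta q < lam k `^ q * c k `^ (s - al * q).
  move=> lk; rewrite ltr_pM2l ?powR_gt0//; apply: ltr_powR => //.
  by have := sq q; lra.
by apply: ltr_leD; [exact: lt|apply: ler_sum => k /andP[lk _]; exact: ltW (lt k lk)].
Qed.

Let Dn := \sum_(i < m | 0 < lam i) c i `^ shat * ln (c i).

Let Dn_lt0 : Dn < 0.
Proof.
have [i li _] := amin_attained; rewrite /Dn (bigD1 i)//=.
have : c i `^ shat * ln (c i) < 0 by rewrite pmulr_rlt0 ?powR_gt0// ln_c_lt0.
have : \sum_(j < m | (0 < lam j) && (j != i)) c j `^ shat * ln (c j) <= 0.
  by apply: sumr_le0 => k _; rewrite mulr_ge0_le0 ?powR_ge0// ltW// ln_c_lt0.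
lra.
Qed.

Let NnE : \sum_(i < m | 0 < lam i) c i `^ shat * ln (lam i) = ahat * Dn.
Proof. by rewrite /alpha_hat divfK// lt_eqF. Qed.

Lemma alpha_hat_bounds : amin <= ahat <= amax.
Proof.
apply/andP; split; rewrite -(ler_nM2r Dn_lt0) -NnE /Dn mulr_sumr.
  apply: ler_sum => i li; rewrite ln_lamE [leRHS]mulrCA ler_wpM2l ?powR_ge0//.
  by rewrite ler_nM2r ?ln_c_lt0// alpha_min_le.
apply: ler_sum => i li; rewrite ln_lamE [leLHS]mulrCA ler_wpM2l ?powR_ge0//.
by rewrite ler_nM2r ?ln_c_lt0// alpha_max_ge.
Qed.

(** An average equals the minimum or the maximum only if all the values coincide. *)
Lemma alpha_hat_extreme (e : R) : `|e| = 1 ->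
  (forall i, 0 < lam i -> 0 <= e * (rho i - ahat)) ->
  forall i, 0 < lam i -> rho i = ahat.
Proof.
move=> e1 He i li.
have H0 : \sum_(k < m | 0 < lam k) e * (rho k - ahat) * (c k `^ shat * - ln (c k)) = 0.
  rewrite (eq_bigr (fun k => e * (ahat * (c k `^ shat * ln (c k)) - c k `^ shat * ln (lam k)))).
    by rewrite -mulr_sumr sumrB -mulr_sumr NnE subrr mulr0.
  by move=> k _; rewrite ln_lamE; ring.
have cl k : 0 < c k `^ shat * - ln (c k).
  by rewrite mulr_gt0 ?powR_gt0// oppr_gt0 ln_c_lt0.
move/eqP: H0; rewrite psumr_eq0 => [/allP/(_ i (mem_index_enum i))|k lk].
  rewrite li /= mulf_eq0 (gt_eqF (cl i)) orbF mulf_eq0 -normr_eq0 e1 oner_eq0/=.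
  by rewrite subr_eq0 => /eqP.
by rewrite mulr_ge0 ?He// ltW.
Qed.

Lemma dim_level_set_le_shat (al : R) : 0 < al ->
  (hausdorff_dim (level_set f al%:E) <= shat%:E)%E.
Proof.
move=> al0; apply: (dim_level_set_le (q := 0)) => //.
rewrite mulr0 subr0 -[leRHS]Hshat; apply: ler_sum => i _.
by rewrite powRr0 mul1r.
Qed.

(** At an end of the range all [rho i] coincide and [dim_extreme] applies. Inside,
    [shat <= ahat * q + beta q] says that [beta] lies above its tangent at 0; it follows from
    [expR x >= 1 + x] in each term of the equation for [beta q]. *)
Lemma dim_level_set_hat : hausdorff_dim (level_set f ahat%:E) = shat%:E.
Proof.
have /andP[h1 h2] := alpha_hat_bounds.
have ah0 : 0 < ahat by exact: lt_le_trans h1.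
have ext (e : R) : `|e| = 1 -> (forall i, 0 < lam i -> 0 <= e * (rho i - ahat)) ->
    hausdorff_dim (level_set f ahat%:E) = shat%:E.
  move=> e1 He; apply: (dim_extreme ah0 shat_ge0 e1 He).
  rewrite -[RHS]Hshat; apply: eq_bigl => i; have [li|//] := boolP (0 < lam i).
  by rewrite (alpha_hat_extreme e1 He)// eqxx.
move: h1; rewrite le_eqVlt => /orP[/eqP h1|h1].
  apply: (ext 1); first exact: normr1.
  by move=> i li; rewrite mul1r subr_ge0 -h1 alpha_min_le.
move: h2; rewrite le_eqVlt => /orP[/eqP h2|h2].
  apply: (ext (-1)); first by rewrite normrN normr1.
  by move=> i li; rewrite mulN1r oppr_ge0 subr_le0 h2 alpha_max_ge.
apply/eqP; rewrite eq_le dim_level_set_le_shat//= dim_level_set_interior ?h1//.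
apply: le_ereal_inf_tmp => _ [q _ <-]; rewrite lee_fin.
have : \sum_(i < m | 0 < lam i) c i `^ shat * (1 + (q * ln (lam i) + (beta q - shat) * ln (c i)))
    <= 1.
  rewrite -[leRHS](Hbeta q); apply: ler_sum => i li.
  rewrite [leRHS](_ : _ = c i `^ shat * expR (q * ln (lam i) + (beta q - shat) * ln (c i))).
    by rewrite ler_pM2l ?powR_gt0// expR_ge1Dx.
  by rewrite !powR_expR// -!expRD; congr expR; ring.
under eq_bigr do rewrite mulrDr mulr1 mulrDr.
rewrite !big_split/= Hshat.
have -> : \sum_(i < m | 0 < lam i) c i `^ shat * (q * ln (lam i)) = q * (ahat * Dn).
  by rewrite -NnE mulr_sumr; apply: eq_bigr => i _; rewrite mulrCA.
have -> : \sum_(i < m | 0 < lam i) c i `^ shat * ((beta q - shat) * ln (c i)) =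
    (beta q - shat) * Dn.
  by rewrite mulr_sumr; apply: eq_bigr => i _; rewrite mulrCA.
by have := Dn_lt0; nra.
Qed.

(** Here [shat = 1] and the [c i] are probabilities, under which [ln (lam i) - al * ln (c i)] has
    mean zero exactly at [al = ahat]. Elsewhere the drift makes a covering sum with [s = 1] less
    than 1. *)
Lemma level_set_hat_full : (forall i, lam i <> 0) ->
  has_lebesgue_measure_one (level_set f ahat%:E).
Proof.
move=> l0; apply: has_lebesgue_measure_one_null; first by move=> t [].
have lpos i : 0 < lam i by rewrite lt_def (lam_ge0 Hsys) andbT; apply/eqP.
have shat1 : shat = 1.
  have Hall : \sum_(i < m) c i `^ shat = 1.
    by rewrite -[RHS]Hshat; apply: eq_bigl => i; rewrite lpos.
  have H1 : \sum_(i < m) c i `^ 1 = 1.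
    by rewrite -[RHS]c_sum; apply: eq_bigr => i _; rewrite powRr1// ltW.
  have [i0 _] := exists_pos.
  have lt (x y : R) : x < y -> \sum_(i < m) c i `^ y < \sum_(i < m) c i `^ x.
    move=> xy; rewrite (bigD1 i0)//= [ltRHS](bigD1 i0)//=.
    apply: ltr_leD; first exact: ltr_powR.
    by apply: ler_sum => i _; apply: ltW; exact: ltr_powR.
  have [h|h|//] := ltgtP shat 1; have := lt _ _ h; rewrite Hall H1 ltxx//.
have /andP[h1 h2] := alpha_hat_bounds.
have ah0 : 0 < ahat by exact: lt_le_trans h1.
(* The sign [e] is -1 below [ahat] and 1 above, so that [q = - e * t] has the sign required by the
   covering bound. *)
have drift (al e : R) : 0 < e * (al - ahat) -> exists2 t : R, 0 < t &
    \sum_(i < m | 0 < lam i) lam i `^ (- e * t) * c i `^ (1 - al * (- e * t)) < 1.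
  move=> eal; have [|t t0 Ht] := @negative_drift _ _ (index_enum 'I_m) c
      (fun i => - e * (ln (lam i) - al * ln (c i))) (fun i => ltW (c_gt0 i)) c_sum.
    rewrite (eq_bigr (fun i => - e * (c i `^ shat * ln (lam i)) -
        - e * al * (c i `^ shat * ln (c i)))).
      rewrite sumrB -!mulr_sumr.
      have -> : \sum_(i < m) c i `^ shat * ln (lam i) = ahat * Dn.
        by rewrite -NnE; apply: eq_bigl => i; rewrite lpos.
      have -> : \sum_(i < m) c i `^ shat * ln (c i) = Dn.
        by apply: eq_bigl => i; rewrite lpos.
      by have := Dn_lt0; nra.
    by move=> i _; rewrite shat1 powRr1 ?(ltW (c_gt0 i))//; ring.
  exists t => //; apply: le_lt_trans Ht; rewrite big_mkcond/=; apply: ler_sum => i _.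
  rewrite lpos !powR_expR// -expRD -{2}[c i]lnK ?posrE// -expRD ler_expR.
  by rewrite le_eqVlt; apply/orP; left; apply/eqP; ring.
(* Countably many levels approach [ahat] from both sides; the denominators start at 2 to keep
   [al1 k] positive. *)
pose al1 k : R := ahat - ahat / k.+2%:R; pose al2 k : R := ahat + ahat / k.+2%:R.
have fr0 k : 0 < ahat / k.+2%:R by rewrite divr_gt0.
have fr1 k : ahat / k.+2%:R < ahat by rewrite ltr_pdivrMr// ltr_pMr// ltr1n.
pose V1 k := [set t : R | 0 < t < 1 /\ (holder_exponent f t < (al1 k)%:E)%E].
pose V2 k := [set t : R | 0 < t < 1 /\ ((al2 k)%:E < holder_exponent f t < +oo)%E].
have V10 k : leb (V1 k) = 0%E.
  apply: hausdorff_measure1_leb.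
  have e0 : 0 < -1 * (al1 k - ahat).
    by rewrite /al1 addrAC subrr add0r mulN1r opprK.
  have [t t0 Ht] := drift _ _ e0.
  apply: (hausdorff_exponent_lt Hsys Hf _ _ _ Ht) => //.
    by rewrite opprK mul1r ltW.
  by rewrite /al1 subr_gt0.
have V20 k : leb (V2 k) = 0%E.
  apply: hausdorff_measure1_leb.
  have e0 : 0 < 1 * (al2 k - ahat) by rewrite /al2 addrAC subrr add0r mul1r.
  have [t t0 Ht] := drift _ _ e0.
  apply: (hausdorff_exponent_gt Hsys Hf _ _ _ Ht) => //.
    by rewrite mulN1r oppr_le0 ltW.
  by rewrite /al2 addr_ge0 ?(ltW (fr0 k)) ?(ltW ah0).
apply: leb_sub0 (leb_setU0 (leb_bigcup0 V10) (leb_bigcup0 V20)) => t [/= t01 nE].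
have et := exponent_finite l0 t01; have et0 := exponent_ge_alpha_min t01.
have small (x : R) : 0 < x -> exists k : nat, ahat / k.+2%:R < x.
  move=> x0; pose k := Num.truncn (ahat / x); exists k.
  rewrite ltr_pdivrMr// mulrC -ltr_pdivrMr//.
  have /andP[_ h] := truncn_itv (ltW (divr_gt0 ah0 x0)).
  by apply: (lt_trans h); rewrite ltr_nat.
move: nE et et0; rewrite /level_set /= /V1 /V2.
case E : (holder_exponent f t) => [r| |] // nE _ _.
have [ra|ar|ra] := ltgtP r ahat.
- have [k hk] := small _ (ltac:(by rewrite subr_gt0) : 0 < ahat - r).
  by left; exists k => //; split => //; rewrite E lte_fin /al1 ltrBrDr addrC -ltrBrDr.
- have [k hk] := small _ (ltac:(by rewrite subr_gt0) : 0 < r - ahat).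
  by right; exists k => //; split => //; rewrite E ltry andbT lte_fin /al2 -ltrBrDl.
- by exfalso; apply: nE; split => //; rewrite ra.
Qed.

End spectrum.

(** Applied to the equations for [smin] and [smax], it shows that the infimum and supremum of [rho]
    are attained, whence the positivity of [alpha_min]. *)
Lemma sum_powR_attained (R : realType) (m : nat) (P : pred 'I_m) (c : 'I_m -> R) s :
  \sum_(i < m | P i) c i `^ s = 1 -> exists i, P i.
Proof.
move=> H; apply: contrapT => nP; move: H; rewrite big1 => [/eqP|i Pi].
  by rewrite eq_sym oner_eq0.
by exfalso; apply: nP; exists i.
Qed.

Theorem theorem2p7 (R : realType) (d m : nat) (eps : 'I_m -> bool)
    (S : 'I_m -> 'rV[R]_d -> 'rV[R]_d) (lam c : 'I_m -> R)
    (f : R -> 'rV[R]_d) (smin smax shat : R) (beta : R -> R)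
    (Hsys : self_affine_system eps lam c S)
    (Hf : self_affine_function eps c S f)
    (smin_ge0 : 0 <= smin)
    (Hsmin : \sum_(i < m | (0 < lam i) && (rho lam c i == alpha_min lam c))
               c i `^ smin = 1)
    (smax_ge0 : 0 <= smax)
    (Hsmax : \sum_(i < m | (0 < lam i) && (rho lam c i == alpha_max lam c))
               c i `^ smax = 1)
    (shat_ge0 : 0 <= shat)
    (Hshat : \sum_(i < m | 0 < lam i) c i `^ shat = 1)
    (Hbeta : forall q : R,
       \sum_(i < m | 0 < lam i) lam i `^ q * c i `^ beta q = 1) :
  let amin := alpha_min lam c in
  let amax := alpha_max lam c in
  let ahat := alpha_hat lam c shat in
  let E := level_set f in
  (* (i) *)
  (forall alpha : \bar R, (0 < alpha)%E ->
     ~ ((amin%:E <= alpha <= amax%:E)%E \/ alpha = +oo%E) ->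
     E alpha = set0) /\
  (* (ii) *)
  (((forall i, lam i <> 0) -> E +oo%E = set0) /\
   ((exists i, lam i = 0) -> has_lebesgue_measure_one (E +oo%E))) /\
  (* (iii) *)
  (forall alpha : R, amin < alpha < amax ->
     hausdorff_dim (E alpha%:E) = beta_star beta alpha) /\
  (* (iv) *)
  (hausdorff_dim (E amin%:E) = smin%:E /\
   hausdorff_dim (E amax%:E) = smax%:E) /\
  (* (v) *)
  (amin <= ahat <= amax /\
   (forall alpha : R, amin <= alpha <= amax ->
      (hausdorff_dim (E alpha%:E) <= hausdorff_dim (E ahat%:E))%E) /\
   hausdorff_dim (E ahat%:E) = shat%:E /\
   ((forall i, lam i <> 0) -> has_lebesgue_measure_one (E ahat%:E))).
Proof.
move=> amin amax ahat E.
have [i /andP[li /eqP ri]] := sum_powR_attained Hsmin.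
have [j /andP[lj /eqP rj]] := sum_powR_attained Hsmax.
have amin_gt0 : 0 < amin by rewrite /amin -ri (rho_gt0 Hsys).
have amin_att : exists2 k, 0 < lam k & rho lam c k = amin by exists i.
have amax_att : exists2 k, 0 < lam k & rho lam c k = amax by exists j.
have amax_gt0 : 0 < amax by rewrite /amax -rj (rho_gt0 Hsys).
have hat := dim_level_set_hat Hsys Hf amin_gt0 shat_ge0 Hshat Hbeta amin_att amax_att.
split; first by move=> al al0 Hal; exact: (level_set_empty Hsys Hf).
split.
  split; first exact: (level_set_pinfty0 Hsys Hf).
  exact: (level_set_pinfty_full Hsys Hf).
split; first by move=> al Hal; exact: (dim_level_set_interior Hsys Hf).
split.
  split.
    apply: (dim_extreme Hsys Hf amin_gt0 smin_ge0 (normr1 R)) => // k lk.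
    by rewrite mul1r subr_ge0 (alpha_min_le Hsys).
  apply: (dim_extreme Hsys Hf (e := -1) amax_gt0 smax_ge0) => //.
    by rewrite normrN normr1.
  by move=> k lk; rewrite mulN1r oppr_ge0 subr_le0 (alpha_max_ge Hsys).
split; first exact: (alpha_hat_bounds Hsys).
split.
  move=> al /andP[al1 _]; rewrite /E hat.
  by apply: (dim_level_set_le_shat Hsys Hf) => //; exact: lt_le_trans al1.
split => //; exact: (level_set_hat_full Hsys Hf).
Qed.
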